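(* Let $k\ge1$ be an integer. Uniformly for all integers $m,n$ with $|m|\beta_n\ge 3\log n$, $$-\Delta_m^2\log N_k(m,n)=\frac{3}{\pi^2}\beta_{n-|m|}^3+O_k\!\left(\beta_{n-|m|}^4\right)\qquad\text{as } n-|m|\to+\infty.$$
   Context: Let $(q;q)_\infty=\prod_{j\ge1}(1-q^j)$. For integers $k\ge 1$ and $m$, $N_k(m,n)$ is defined by $\sum_{n\ge 0}N_{k}(m,n)q^n=\frac{1}{(q;q)_{\infty}}\sum_{n\ge 1}(-1)^{n-1}q^{n((2k-1)n-1)/2+|m|n}(1-q^n)$. For a positive integer $\ell$, $\beta_\ell=\pi/\sqrt{6(\ell-1/24)}$. $\Delta_m^2 g(m)=g(m+1)-2g(m)+g(m-1)$. *)

(* Defs.v *)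
From Stdlib Require Import Reals ZArith Arith List Lia Lra.
Open Scope R_scope.

Definition zsum (l : list nat) (f : nat -> Z) : Z :=
  fold_right (fun i acc => (f i + acc)%Z) 0%Z l.

(* pp j n = coefficient of q^n in prod_{i=1}^{j} 1/(1-q^i)
   (= number of partitions of n into parts <= j), obtained by expanding
   1/(1-q^j) = sum_{i>=0} q^{i j} and recursing on j. *)
Fixpoint pp (j n : nat) : Z :=
  match j with
  | O => if Nat.eqb n 0 then 1%Z else 0%Z
  | S j' => zsum (seq 0 (S (n / S j'))) (fun i => pp j' (n - i * S j'))
  end.

(* coefficient of q^n in 1/(q;q)_infinity (only factors with index <= n matter) *)
Definition pcoef (n : nat) : Z := pp n n.

Definition expo (k : nat) (m : Z) (j : nat) : nat :=
  (j * ((2 * k - 1) * j - 1)) / 2 + Z.to_nat (Z.abs m) * j.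

(* coefficient of q^t in sum_{j>=1} (-1)^(j-1) q^{expo j} (1 - q^j);
   since expo j >= j (for k >= 1), only j <= t contribute. *)
Definition acoef (k : nat) (m : Z) (t : nat) : Z :=
  zsum (seq 1 t) (fun j =>
    ((if Nat.even j then (-1)%Z else 1%Z) *
     ((if Nat.eqb (expo k m j) t then 1%Z else 0%Z)
      - (if Nat.eqb (expo k m j + j) t then 1%Z else 0%Z)))%Z).

Definition Nk (k : nat) (m : Z) (n : nat) : Z :=
  zsum (seq 0 (S n)) (fun t => (pcoef (n - t) * acoef k m t)%Z).

Definition beta (l : R) : R := PI / sqrt (6 * (l - 1 / 24)).

Definition Delta2 (g : Z -> R) (m : Z) : R := g (m + 1)%Z - 2 * g m + g (m - 1)%Z.

Definition logN (k : nat) (n : nat) (m : Z) : R := ln (IZR (Nk k m n)).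

(* Main.v *)
Require Import Defs.
From Stdlib Require Import Reals ZArith Arith List Lia Lra Psatz.
From Coquelicot Require Import Coquelicot.
Open Scope R_scope.

(* Put [M = |m|], [N = n - M], [a = beta N] and let [Q z = p(z) - p(z-1)], the number of
   partitions of [z] without part 1. The first term of the alternating sum is [Q r] with
   [r = N - (k-1)]; since [a M >= 3 log n], the others are smaller by a factor [O(a^4)].
   So one needs the second difference of [log Q]. Fourier inversion on the circle
   [|q| = e^{-a}] gives, up to an explicit factor [c e^{az}],
   [Q z = int_0^pi w cos(B - (z - r) th)], where [w] and [B] are the modulus and the phase of
   the (normalised, centred) generating function. Hence [Q (r+1)] and [Q (r-1)] correspond to
   [I - D + S] and [I - D - S], with [I = int w cos B], [D = int w cos B (1 - cos th)] and
   [S = int w sin B sin th], and minus the second difference is about [2 D / I]. Replacing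
   [w cos B] by the Gaussian [exp(- pi^2/(6 a^3) th^2)], which costs a relative error [O(a)],
   integration by parts gives [2 D / I = 3 a^3 / pi^2 + O(a^4)], while [S / I = O(a^2)].
   No modular transformation is needed: the phase and the variance only involve the Riemann
   sums of [y/(e^y-1)] and [y^2 e^y/(e^y-1)^2], whose integrals come from the Basel sum. *)

(** The natural unit is [h = sqrt a]: the Gaussian has width [h^3], and on that scale the phase [B]
    is only [O(h)], the square root of the permitted relative error. This is harmless for parity
    reasons. In [I] and [D] the phase enters through [cos B], at cost [B^2 = O(a)]. In [S] it enters
    linearly, but [S] cancels to first order between [log (I - D + S)] and [log (I - D - S)], so
    [S / I = O(a^2)] contributes only its square, [O(a^4)]. The choice [a = beta N] is the saddle
    point, [PI^2 / (6 a^2) = N - 1/24]; any centre within [O(1 / a)] of it would do, so the shift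
    [k - 1] in [r] needs no correction. Part 1 is missing from [Q] because the factor [1 - q] of the
    first term cancels it. The 3 in [3 log n] is matched to the target: as [beta n <= a], one gets
    [e^{-aM} <= n^{-3} <= a^6], and division by [I], of order [a^(3/2)], leaves [O(a^(9/2))]. *)

(** * Elementary calculus and trigonometric inequalities *)

Lemma mean_value_between (f df : R -> R) (m M a b : R) :
  a <= b ->
  (forall x, a <= x <= b -> is_derive f x (df x)) ->
  (forall x, a <= x <= b -> m <= df x <= M) ->
  m * (b - a) <= f b - f a <= M * (b - a).
Proof.
  intros hab hd hb.
  destruct (MVT_gen f a b df) as [c [hc e]];
    rewrite ?(Rmin_left a b), ?(Rmax_right a b) in * by assumption.
  - intros x hx; apply hd; lra.
  - intros x hx; apply continuity_pt_filterlim.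
    apply (ex_derive_continuous f x); exists (df x); apply hd; lra.
  - rewrite e; specialize (hb c hc).
    split; apply Rmult_le_compat_r; lra.
Qed.

Lemma nondecreasing_of_derive (f df : R -> R) (a b : R) :
  a <= b ->
  (forall x, a <= x <= b -> is_derive f x (df x)) ->
  (forall x, a <= x <= b -> 0 <= df x) -> f a <= f b.
Proof.
  intros hab hd hp.
  destruct (MVT_gen f a b df) as [c [hc e]];
    rewrite ?(Rmin_left a b), ?(Rmax_right a b) in * by assumption.
  - intros x hx; apply hd; lra.
  - intros x hx; apply continuity_pt_filterlim.
    apply (ex_derive_continuous f x); exists (df x); apply hd; lra.
  - specialize (hp c hc); nra.
Qed.

Lemma one_sub_cos_le (x : R) : 0 <= x -> 1 - cos x <= x ^ 2 / 2.
Proof.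
  intros hx.
  enough (0 ^ 2 / 2 + cos 0 <= x ^ 2 / 2 + cos x) as h by (rewrite cos_0 in h; lra).
  apply (nondecreasing_of_derive (fun t => t ^ 2 / 2 + cos t) (fun t => t - sin t)); auto.
  - intros t _; auto_derive; auto; field.
  - intros t ht; destruct (Req_dec t 0) as [-> | h]; [rewrite sin_0; lra |].
    generalize (sin_lt_x t); lra.
Qed.

Lemma sin_ge_cubic (x : R) : 0 <= x -> x - x ^ 3 / 6 <= sin x.
Proof.
  intros hx.
  enough (sin 0 - (0 - 0 ^ 3 / 6) <= sin x - (x - x ^ 3 / 6)) as h
    by (rewrite sin_0 in h; lra).
  apply (nondecreasing_of_derive (fun t => sin t - (t - t ^ 3 / 6))
           (fun t => cos t - (1 - t ^ 2 / 2))); auto.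
  - intros t _; auto_derive; auto; field.
  - intros t ht; generalize (one_sub_cos_le t); lra.
Qed.

Lemma one_sub_cos_ge (x : R) : 0 <= x -> x ^ 2 / 2 - x ^ 4 / 24 <= 1 - cos x.
Proof.
  intros hx.
  enough (- cos 0 - (0 ^ 2 / 2 - 0 ^ 4 / 24) <= - cos x - (x ^ 2 / 2 - x ^ 4 / 24)) as h
    by (rewrite cos_0 in h; lra).
  apply (nondecreasing_of_derive (fun t => - cos t - (t ^ 2 / 2 - t ^ 4 / 24))
           (fun t => sin t - (t - t ^ 3 / 6))); auto.
  - intros t _; auto_derive; auto; field.
  - intros t ht; generalize (sin_ge_cubic t); lra.
Qed.

Lemma cos_le_quartic (x : R) : 0 <= x -> cos x <= 1 - x ^ 2 / 2 + x ^ 4 / 24.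
Proof. intros hx; generalize (one_sub_cos_ge x hx); lra. Qed.

(** At [8/5] the quartic upper bound for the cosine is already negative, while [cos] is nonnegative
    up to [PI / 2]. *)
Lemma PI_lt_16_5 : PI < 16 / 5.
Proof.
  destruct (Rlt_le_dec PI (16 / 5)) as [h | h]; auto.
  generalize (cos_le_quartic (8 / 5)) (cos_ge_0 (8 / 5)).
  lra.
Qed.

Lemma PI_gt_3 : 3 < PI.
Proof. generalize PI2_3_2; unfold PI2; lra. Qed.

Lemma sin_ge_half (x : R) : 0 <= x <= PI / 2 -> x / 2 <= sin x.
Proof.
  intros hx; generalize (sin_ge_cubic x (proj1 hx)) PI_lt_16_5; intros h hp.
  assert (x ^ 2 <= 3) by nra. nra.
Qed.

Lemma one_sub_cos_ge_eighth (x : R) : 0 <= x <= PI -> x ^ 2 / 8 <= 1 - cos x.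
Proof.
  intros hx.
  replace x with (2 * (x / 2)) at 2 by field; rewrite cos_2a_sin.
  generalize (sin_ge_half (x / 2)); nra.
Qed.

(** * Wallis integrals and the Basel sum with an explicit remainder *)

Lemma is_RInt_of_primitive (F f : R -> R) (a b : R) :
  (forall x, is_derive F x (f x)) -> (forall x, continuous f x) ->
  is_RInt f a b (F b - F a).
Proof.
  intros hF hf; apply (is_RInt_derive F f); intros; auto.
Qed.

Lemma ex_RInt_of_continuous (f : R -> R) (a b : R) :
  (forall x, continuous f x) -> ex_RInt f a b.
Proof. intros h; apply (ex_RInt_continuous f); auto. Qed.

(** The recurrences for these two integrals turn [1 / (n + 1)^2] into a difference of consecutive
    ratios [wallis2 / wallis]. This evaluates the Basel sum and bounds its remainder at the same
    time. *)
Definition wallis (n : nat) : R := RInt (fun x => cos x ^ (2 * n)) 0 (PI / 2).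
Definition wallis2 (n : nat) : R := RInt (fun x => x ^ 2 * cos x ^ (2 * n)) 0 (PI / 2).

Lemma continuous_of_ex_derive (f : R -> R) (x : R) : ex_derive f x -> continuous f x.
Proof. apply (ex_derive_continuous f). Qed.

Lemma wallis_ex (n : nat) : ex_RInt (fun x => cos x ^ (2 * n)) 0 (PI / 2).
Proof.
  apply ex_RInt_of_continuous; intros x; apply continuous_of_ex_derive; auto_derive; auto.
Qed.

Lemma wallis2_ex (n : nat) : ex_RInt (fun x => x ^ 2 * cos x ^ (2 * n)) 0 (PI / 2).
Proof.
  apply ex_RInt_of_continuous; intros x; apply continuous_of_ex_derive; auto_derive; auto.
Qed.

Lemma wallis_pos (n : nat) : 0 < wallis n.
Proof.
  apply RInt_gt_0.
  - generalize PI_gt_3; lra.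
  - intros x hx; apply pow_lt, cos_gt_0; lra.
  - intros x _; apply continuous_of_ex_derive; auto_derive; auto.
Qed.


Lemma is_RInt_lin (f g : R -> R) (a b c d u v : R) :
  is_RInt f a b u -> is_RInt g a b v ->
  is_RInt (fun x => c * f x + d * g x) a b (c * u + d * v).
Proof.
  intros hf hg.
  apply (is_RInt_plus (V := R_NormedModule) (fun x => c * f x) (fun x => d * g x));
    apply (is_RInt_scal (V := R_NormedModule)); assumption.
Qed.

Lemma RInt_lin (f g : R -> R) (a b c d : R) :
  ex_RInt f a b -> ex_RInt g a b ->
  RInt (fun x => c * f x + d * g x) a b = c * RInt f a b + d * RInt g a b.
Proof.
  intros hf hg; apply is_RInt_unique, is_RInt_lin;
    apply (RInt_correct (V := R_CompleteNormedModule)); assumption.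
Qed.

Lemma RInt_sub (f g : R -> R) (a b : R) :
  ex_RInt f a b -> ex_RInt g a b ->
  RInt f a b - RInt g a b = RInt (fun x => 1 * f x + -1 * g x) a b.
Proof. intros hf hg; rewrite RInt_lin by auto; rewrite Rmult_1_l; lra. Qed.

Lemma Rabs_RInt_le (f g : R -> R) (a b : R) :
  a <= b -> ex_RInt f a b -> ex_RInt g a b ->
  (forall x, a < x < b -> Rabs (f x) <= g x) -> Rabs (RInt f a b) <= RInt g a b.
Proof.
  intros hab hf hg h; apply Rabs_le; split.
  - replace (- RInt g a b) with (-1 * RInt g a b + 0 * RInt g a b) by ring.
    rewrite <- RInt_lin by auto; apply RInt_le; auto.
    + exists (-1 * RInt g a b + 0 * RInt g a b).
      apply is_RInt_lin; apply (RInt_correct (V := R_CompleteNormedModule)); auto.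
    + intros x hx; generalize (h x hx); intros h'; apply Rabs_le_between in h'; lra.
  - apply RInt_le; auto; intros x hx; generalize (h x hx); intros h'.
    apply Rabs_le_between in h'; lra.
Qed.

Lemma wallis_succ (n : nat) :
  (2 * INR n + 2) * wallis (S n) = (2 * INR n + 1) * wallis n.
Proof.
  assert (h : is_RInt (fun x => (2 * INR n + 2) * cos x ^ (2 * S n)
                                + - (2 * INR n + 1) * cos x ^ (2 * n)) 0 (PI / 2)
                (sin (PI / 2) * cos (PI / 2) ^ (2 * n + 1) - sin 0 * cos 0 ^ (2 * n + 1))).
  { apply (is_RInt_of_primitive (fun x => sin x * cos x ^ (2 * n + 1))).
    - intros x; auto_derive; auto; simpl Nat.pred.
      replace (Init.Nat.pred (n + (n + 0) + 1)) with (2 * n)%nat by lia.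
      replace (n + (n + 0) + 1)%nat with (S (2 * n))%nat by lia.
      replace (2 * S n)%nat with (S (S (2 * n)))%nat by lia.
      rewrite S_INR, mult_INR; rewrite <- !tech_pow_Rmult; simpl (INR 2).
      generalize (sin2_cos2 x); unfold Rsqr; intros e.
      set (y := cos x ^ (2 * n)).
      transitivity (cos x * cos x * y - (2 * INR n + 1) * (sin x * sin x) * y); [ring |].
      replace (sin x * sin x) with (1 - cos x * cos x) by lra; ring.
    - intros x; apply continuous_of_ex_derive; auto_derive; auto. }
  rewrite cos_PI2, sin_0, (pow_i (2 * n + 1)) in h by lia.
  apply (is_RInt_unique (V := R_CompleteNormedModule)) in h.
  rewrite RInt_lin in h by apply wallis_ex.
  fold (wallis n) (wallis (S n)) in h. lra.
Qed.

(** Two integrations by parts of [cos^(2n+2)]; [F] collects both boundary terms, which vanish at [0]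
    and at [PI / 2]. *)
Lemma wallis2_succ (n : nat) :
  wallis (S n) + 2 * (INR n + 1) ^ 2 * wallis2 (S n)
  = (INR n + 1) * (2 * INR n + 1) * wallis2 n.
Proof.
  set (F := fun x => x * cos x ^ (2 * n + 2) + (INR n + 1) * (x ^ 2 * (sin x * cos x ^ (2 * n + 1)))).
  assert (h : is_RInt (fun x => 1 * cos x ^ (2 * S n) +
                 1 * (2 * (INR n + 1) ^ 2 * (x ^ 2 * cos x ^ (2 * S n))
                  + - ((INR n + 1) * (2 * INR n + 1)) * (x ^ 2 * cos x ^ (2 * n))))
                0 (PI / 2) (F (PI / 2) - F 0)).
  { apply (is_RInt_of_primitive F).
    - intros x; unfold F; auto_derive; auto; simpl Nat.pred.
      replace (Init.Nat.pred (n + (n + 0) + 1)) with (2 * n)%nat by lia.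
      replace (Init.Nat.pred (n + (n + 0) + 2)) with (S (2 * n))%nat by lia.
      replace (n + (n + 0) + 1)%nat with (S (2 * n))%nat by lia.
      replace (n + (n + 0) + 2)%nat with (S (S (2 * n)))%nat by lia.
      replace (2 * S n)%nat with (S (S (2 * n)))%nat by lia.
      rewrite !S_INR, mult_INR; rewrite <- !tech_pow_Rmult; simpl (INR 2).
      generalize (sin2_cos2 x); unfold Rsqr; intros e.
      set (y := cos x ^ (2 * n)).
      transitivity (cos x * cos x * y + (INR n + 1) * x ^ 2 * (cos x * cos x) * y
                    - (INR n + 1) * (2 * INR n + 1) * x ^ 2 * (sin x * sin x) * y); [ring |].
      replace (sin x * sin x) with (1 - cos x * cos x) by lra; ring.
    - intros x; apply continuous_of_ex_derive; auto_derive; auto. }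
  unfold F in h; rewrite cos_PI2, sin_0, (pow_i (2 * n + 1)), (pow_i (2 * n + 2)) in h by lia.
  apply (is_RInt_unique (V := R_CompleteNormedModule)) in h.
  rewrite RInt_lin in h; [rewrite RInt_lin in h by apply wallis2_ex | apply wallis_ex |].
  - fold (wallis (S n)) (wallis2 n) (wallis2 (S n)) in h. lra.
  - exists (2 * (INR n + 1) ^ 2 * wallis2 (S n) + - ((INR n + 1) * (2 * INR n + 1)) * wallis2 n).
    apply is_RInt_lin; apply (RInt_correct (V := R_CompleteNormedModule)), wallis2_ex.
Qed.

(** Since [x <= 2 sin x] on this interval, the weight [x^2] is at most [4 (1 - cos^2 x)], so
    [wallis2 n] is dominated by four times the gap [wallis n - wallis (S n)]. *)
Lemma wallis2_bound (n : nat) : 0 <= wallis2 n <= 4 * wallis n / (2 * INR n + 2).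
Proof.
  generalize PI_gt_3; intros hpi; split.
  - apply RInt_ge_0; [lra | apply wallis2_ex |].
    intros x hx; apply Rmult_le_pos; [nra |]; apply pow_le, cos_ge_0; lra.
  - apply Rle_trans with (4 * wallis n + -4 * wallis (S n)).
    + unfold wallis; rewrite <- RInt_lin by apply wallis_ex.
      apply RInt_le; [lra | apply wallis2_ex | |].
      * exists (4 * wallis n + -4 * wallis (S n)).
        apply is_RInt_lin; apply (RInt_correct (V := R_CompleteNormedModule)), wallis_ex.
      * intros x hx.
        replace (2 * S n)%nat with (S (S (2 * n)))%nat by lia.
        rewrite <- !tech_pow_Rmult.
        assert (hc : 0 <= cos x ^ (2 * n)) by (apply pow_le, cos_ge_0; lra).
        generalize (sin2_cos2 x) (sin_ge_half x); unfold Rsqr; intros e hs.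
        assert (hq : x ^ 2 <= 4 * (sin x * sin x)) by (specialize (hs ltac:(lra)); nra).
        replace (4 * cos x ^ (2 * n) + -4 * (cos x * (cos x * cos x ^ (2 * n))))
          with (4 * (1 - cos x * cos x) * cos x ^ (2 * n)) by ring.
        apply Rmult_le_compat_r; lra.
    + generalize (wallis_succ n) (pos_INR n) (wallis_pos n); intros e hn hw.
      replace (wallis (S n)) with ((2 * INR n + 1) * wallis n / (2 * INR n + 2))
        by (rewrite <- e; field; lra).
      right; field; lra.
Qed.

Fixpoint psum (f : nat -> R) (n : nat) : R :=
  match n with O => 0 | S n' => psum f n' + f n end.

Lemma psum_succ (f : nat -> R) (n : nat) : psum f (S n) = psum f n + f (S n).
Proof. reflexivity. Qed.

(* Telescoping of [wallis2 n / wallis n]. *)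
Lemma basel_wallis (n : nat) :
  psum (fun i => 1 / INR i ^ 2) n = PI ^ 2 / 6 - 2 * wallis2 n / wallis n.
Proof.
  induction n as [| n IH].
  - assert (h1 : wallis 0 = PI / 2).
    { apply is_RInt_unique.
      replace (PI / 2) with ((fun x : R => x) (PI / 2) - (fun x : R => x) 0) at 2 by lra.
      apply (is_RInt_of_primitive (fun x => x)).
      - intros x; auto_derive; simpl; auto.
      - intros x; apply continuous_of_ex_derive; auto_derive; auto. }
    assert (h2 : wallis2 0 = (PI / 2) ^ 3 / 3).
    { apply is_RInt_unique.
      replace ((PI / 2) ^ 3 / 3) with ((fun x : R => x ^ 3 / 3) (PI / 2) - (fun x : R => x ^ 3 / 3) 0)
        by (simpl; field).
      apply (is_RInt_of_primitive (fun x => x ^ 3 / 3)).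
      - intros x; auto_derive; auto; simpl; field.
      - intros x; apply continuous_of_ex_derive; auto_derive; auto. }
    simpl psum; rewrite h1, h2; field; generalize PI_gt_3; lra.
  - rewrite psum_succ, IH.
    generalize (wallis_succ n) (wallis2_succ n) (wallis_pos n) (wallis_pos (S n)) (pos_INR n).
    intros e1 e2 p1 p2 hn.
    rewrite S_INR.
    assert (e3 : wallis n = (2 * INR n + 2) * wallis (S n) / (2 * INR n + 1))
      by (rewrite e1; field; lra).
    assert (e4 : wallis2 n = (wallis (S n) + 2 * (INR n + 1) ^ 2 * wallis2 (S n))
                             / ((INR n + 1) * (2 * INR n + 1)))
      by (rewrite e2; field; lra).
    rewrite e3, e4; field; lra.
Qed.

Lemma basel_bound (n : nat) :
  PI ^ 2 / 6 - 4 / (INR n + 1) <= psum (fun i => 1 / INR i ^ 2) n <= PI ^ 2 / 6.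
Proof.
  rewrite basel_wallis.
  generalize (wallis2_bound n) (wallis_pos n) (pos_INR n); intros [h1 h2] hw hn.
  assert (0 <= wallis2 n / wallis n) by (apply Rdiv_le_0_compat; lra).
  assert (wallis2 n / wallis n <= 2 / (INR n + 1)).
  { apply Rle_div_l; auto.
    replace (2 / (INR n + 1) * wallis n) with (4 * wallis n / (2 * INR n + 2)); auto.
    field; lra. }
  unfold Rdiv in *; lra.
Qed.

(** * Riemann sums of Bose functions *)

Lemma psum_le (f g : nat -> R) (n : nat) :
  (forall i, (1 <= i <= n)%nat -> f i <= g i) -> psum f n <= psum g n.
Proof.
  induction n as [| n IH]; intros h; simpl; [lra |].
  apply Rplus_le_compat; [apply IH; intros; apply h | apply h]; lia.
Qed.

Lemma psum_ext (f g : nat -> R) (n : nat) :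
  (forall i, (1 <= i <= n)%nat -> f i = g i) -> psum f n = psum g n.
Proof.
  intros h; apply Rle_antisym; apply psum_le; intros i hi; rewrite h by auto; lra.
Qed.

Lemma psum_scal (c : R) (f : nat -> R) (n : nat) :
  psum (fun i => c * f i) n = c * psum f n.
Proof. induction n as [| n IH]; simpl; [| rewrite IH]; ring. Qed.

Lemma psum_sub_scal (c : R) (f g : nat -> R) (n : nat) :
  psum (fun i => f i - c * g i) n = psum f n - c * psum g n.
Proof. induction n as [| n IH]; simpl; [| rewrite IH]; ring. Qed.

Lemma psum_nonneg (f : nat -> R) (n : nat) :
  (forall i, (1 <= i <= n)%nat -> 0 <= f i) -> 0 <= psum f n.
Proof.
  intros h; replace 0 with (psum (fun _ => 0) n); [now apply psum_le |].
  induction n as [| n IH]; simpl; [| rewrite IH; [ring | intros; apply h; lia]]; reflexivity.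
Qed.

Lemma psum_abs (f g : nat -> R) (n : nat) :
  (forall i, (1 <= i <= n)%nat -> Rabs (f i) <= g i) -> Rabs (psum f n) <= psum g n.
Proof.
  induction n as [| n IH]; intros h; simpl; [rewrite Rabs_R0; lra |].
  eapply Rle_trans; [apply Rabs_triang |].
  apply Rplus_le_compat; [apply IH; intros; apply h | apply h]; lia.
Qed.

Lemma psum_mono (f : nat -> R) (n m : nat) :
  (n <= m)%nat -> (forall i, (1 <= i <= m)%nat -> 0 <= f i) -> psum f n <= psum f m.
Proof.
  intros hnm; induction hnm as [| m hnm IH]; intros h; [lra |].
  simpl; generalize (h (S m) ltac:(lia)) (IH ltac:(intros; apply h; lia)); simpl; lra.
Qed.

Lemma psum_geometric (x : R) (n : nat) :
  0 <= x < 1 -> psum (fun i => x ^ i) n <= x / (1 - x).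
Proof.
  intros hx.
  replace (psum (fun i => x ^ i) n) with (x / (1 - x) - x ^ (n + 1) / (1 - x)).
  - assert (0 <= x ^ (n + 1) / (1 - x)) by (apply Rdiv_le_0_compat; [apply pow_le |]; lra); lra.
  - induction n as [| n IH]; simpl; [field; lra |].
    rewrite <- IH; rewrite !pow_add; simpl; field; lra.
Qed.

Lemma psum_exp_le (c : R) (n : nat) :
  0 < c -> psum (fun i => exp (- (INR i * c))) n <= 1 / c.
Proof.
  intros hc.
  assert (he : exp (- c) * (1 + c) <= 1).
  { rewrite exp_Ropp; generalize (exp_ineq1_le c) (exp_pos c); intros.
    apply Rmult_le_reg_l with (exp c); auto; field_simplify; lra. }
  generalize (exp_pos (- c)); intros hp.
  rewrite (psum_ext _ (fun i => exp (- c) ^ i)).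
  - eapply Rle_trans; [apply psum_geometric; split; [lra | nra] |].
    apply Rle_div_l; [nra |].
    replace (1 / c * (1 - exp (- c))) with ((1 - exp (- c)) / c) by (field; lra).
    apply Rle_div_r; lra.
  - intros i _; rewrite <- Rpower_pow by auto; unfold Rpower; rewrite ln_exp; f_equal; ring.
Qed.

(** Raise [x / n <= exp (x / n)] to the power [n]. *)
Lemma pow_div_fact_le_exp (n : nat) (x : R) : 0 <= x -> (0 < n)%nat ->
  x ^ n <= INR n ^ n * exp x.
Proof.
  intros hx hn.
  assert (hn' : 0 < INR n) by (apply lt_0_INR; lia).
  replace x with (INR n * (x / INR n)) at 1 by (field; lra).
  replace x with (INR n * (x / INR n)) at 2 by (field; lra).
  rewrite Rpow_mult_distr.
  apply Rmult_le_compat_l; [apply pow_le; lra |].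
  replace (exp (INR n * (x / INR n))) with (exp (x / INR n) ^ n).
  - apply pow_incr; split; [apply Rdiv_le_0_compat; lra |].
    generalize (exp_ineq1_le (x / INR n)); lra.
  - rewrite <- Rpower_pow by apply exp_pos; unfold Rpower; rewrite ln_exp; reflexivity.
Qed.

Lemma exp_ge_quadratic (y : R) : 0 <= y -> 1 + y + y ^ 2 / 2 <= exp y.
Proof.
  intros hy; enough (exp 0 - (1 + 0 + 0 ^ 2 / 2) <= exp y - (1 + y + y ^ 2 / 2)) as h
    by (rewrite exp_0 in h; lra).
  apply (nondecreasing_of_derive (fun y => exp y - (1 + y + y ^ 2 / 2))
           (fun y => exp y - (1 + y))); [lra | |].
  - intros x _; auto_derive; auto; field.
  - intros x _; generalize (exp_ineq1_le x); lra.
Qed.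

Lemma exp_ge_cubic (y : R) : 0 <= y -> 1 + y + y ^ 2 / 2 + y ^ 3 / 6 <= exp y.
Proof.
  intros hy; enough (exp 0 - (1 + 0 + 0 ^ 2 / 2 + 0 ^ 3 / 6)
                     <= exp y - (1 + y + y ^ 2 / 2 + y ^ 3 / 6)) as h
    by (rewrite exp_0 in h; lra).
  apply (nondecreasing_of_derive (fun y => exp y - (1 + y + y ^ 2 / 2 + y ^ 3 / 6))
           (fun y => exp y - (1 + y + y ^ 2 / 2))); [lra | |].
  - intros x _; auto_derive; auto; field.
  - intros x hx; generalize (exp_ge_quadratic x); lra.
Qed.

Section RiemannSum.
Variables (f P dP : R -> R) (a : R).
Hypothesis ha : 0 < a.
Hypothesis hf : forall x y, 0 < x -> x <= y -> f y <= f x.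
Hypothesis hP : forall x, 0 < x -> is_derive P x (dP x).

(** Comparison of a decreasing function with its integral. The derivative of [P] is only compared
    with [f] from one side, because truncated series will stand in for the primitive. Sampling
    starts at [2 a] since the smallest part is 2. *)
Lemma riemann_sum_ge (n : nat) : (forall x, 0 < x -> dP x <= f x) ->
  P (INR (n + 2) * a) - P (2 * a) <= psum (fun i => a * f (INR (S i) * a)) n.
Proof.
  intros h; induction n as [| n IH]; [simpl; replace (1 + 1) with 2 by ring; lra |].
  rewrite psum_succ.
  apply Rle_trans with
    (P (INR (n + 2) * a) - P (2 * a) + (P (INR (S n + 2) * a) - P (INR (n + 2) * a))); [lra |].
  apply Rplus_le_compat; auto.
  replace (S (S n)) with (n + 2)%nat by lia.
  replace (INR (S n + 2)) with (INR (n + 2) + 1) by (rewrite !plus_INR, (S_INR n); ring).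
  assert (hn : 0 < INR (n + 2)) by (apply lt_0_INR; lia).
  destruct (MVT_gen P (INR (n + 2) * a) ((INR (n + 2) + 1) * a) dP) as [c [hc e]];
    rewrite ?(Rmin_left (INR (n + 2) * a)), ?(Rmax_right (INR (n + 2) * a)) in * by nra.
  - intros x hx; apply hP; nra.
  - intros x hx; apply continuity_pt_filterlim.
    apply (ex_derive_continuous P x); exists (dP x); apply hP; nra.
  - rewrite e; generalize (h c ltac:(nra)) (hf (INR (n + 2) * a) c ltac:(nra) ltac:(lra)); nra.
Qed.

Lemma riemann_sum_le (n : nat) : (forall x, 0 < x -> f x <= dP x) ->
  psum (fun i => a * f (INR (S i) * a)) n <= P (INR (n + 1) * a) - P a.
Proof.
  intros h; induction n as [| n IH]; [simpl; rewrite Rmult_1_l; lra |].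
  rewrite psum_succ.
  apply Rle_trans with
    (P (INR (n + 1) * a) - P a + (P (INR (S n + 1) * a) - P (INR (n + 1) * a))); [| lra].
  apply Rplus_le_compat; auto.
  replace (S (S n)) with (S n + 1)%nat by lia.
  replace (INR (S n + 1)) with (INR (n + 1) + 1) by (rewrite !plus_INR, (S_INR n); ring).
  assert (hn : 0 < INR (n + 1)) by (apply lt_0_INR; lia).
  destruct (MVT_gen P (INR (n + 1) * a) ((INR (n + 1) + 1) * a) dP) as [c [hc e]];
    rewrite ?(Rmin_left (INR (n + 1) * a)), ?(Rmax_right (INR (n + 1) * a)) in * by nra.
  - intros x hx; apply hP; nra.
  - intros x hx; apply continuity_pt_filterlim.
    apply (ex_derive_continuous P x); exists (dP x); apply hP; nra.
  - rewrite e; generalize (h c ltac:(nra)) (hf c ((INR (n + 1) + 1) * a) ltac:(nra) ltac:(lra)); nra.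
Qed.
End RiemannSum.

(** With [x = e^{-y}] these are [y x / (1 - x)] and [y^2 x / (1 - x)^2], the leading coefficients of
    the phase and of the log modulus of a single factor, see [phase_approx] and [ln_modq_approx]. *)
Definition bose (y : R) : R := y / (exp y - 1).
Definition bose2 (y : R) : R := y ^ 2 * exp y / (exp y - 1) ^ 2.

Lemma exp_sub1_pos (y : R) : 0 < y -> 0 < exp y - 1.
Proof. intros h; generalize (exp_ineq1 y); lra. Qed.

Lemma bose_bounds (y : R) : 0 < y -> 0 < bose y <= 1.
Proof.
  intros h; generalize (exp_sub1_pos y h) (exp_ineq1_le y); intros; unfold bose; split.
  - apply Rdiv_lt_0_compat; lra.
  - apply Rle_div_l; lra.
Qed.

Lemma nonincreasing_of_derive_pos (f df : R -> R) :
  (forall x, 0 < x -> is_derive f x (df x)) -> (forall x, 0 < x -> df x <= 0) ->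
  forall x y, 0 < x -> x <= y -> f y <= f x.
Proof.
  intros hd hn x y hx hxy.
  enough (- f x <= - f y) by lra.
  apply (nondecreasing_of_derive (fun t => - f t) (fun t => - df t)); auto.
  - intros t ht; apply (is_derive_opp f), hd; lra.
  - intros t ht; generalize (hn t); lra.
Qed.

Lemma bose_decr (x y : R) : 0 < x -> x <= y -> bose y <= bose x.
Proof.
  revert x y.
  apply (nonincreasing_of_derive_pos bose (fun y => (exp y - 1 - y * exp y) / (exp y - 1) ^ 2)).
  - intros x hx; unfold bose; generalize (exp_sub1_pos x hx); intros.
    auto_derive; [lra | field; lra].
  - intros x hx; generalize (exp_sub1_pos x hx) (exp_ineq1_le (- x)) (exp_pos x).
    rewrite exp_Ropp; intros h1 h2 h3.
    assert (h4 : exp x * (1 + - x) <= exp x * / exp x) by (apply Rmult_le_compat_l; lra).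
    rewrite Rinv_r in h4 by lra.
    apply Rle_div_l; [apply pow_lt; lra | lra].
Qed.

Lemma bose2_decr (x y : R) : 0 < x -> x <= y -> bose2 y <= bose2 x.
Proof.
  revert x y.
  apply (nonincreasing_of_derive_pos bose2
    (fun y => y * exp y * (2 * (exp y - 1) - y * (exp y + 1)) / (exp y - 1) ^ 3)).
  - intros x hx; unfold bose2; generalize (exp_sub1_pos x hx); intros.
    auto_derive; [nra | field; lra].
  - intros x hx; generalize (exp_sub1_pos x hx) (exp_pos x); intros h1 h2.
    assert (h3 : 0 * (exp 0 + 1) - 2 * (exp 0 - 1) <= x * (exp x + 1) - 2 * (exp x - 1)).
    { apply (nondecreasing_of_derive (fun x => x * (exp x + 1) - 2 * (exp x - 1))
               (fun x => 1 + x * exp x - exp x)); [lra | |].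
      - intros t _; auto_derive; auto; ring.
      - intros t ht; generalize (exp_ineq1_le (- t)) (exp_pos t).
        rewrite exp_Ropp; intros h4 h5.
        assert (h6 : exp t * (1 + - t) <= exp t * / exp t) by (apply Rmult_le_compat_l; lra).
        rewrite Rinv_r in h6 by lra; lra. }
    rewrite exp_0 in h3.
    apply Rle_div_l; [apply pow_lt; lra |].
    assert (0 < x * exp x) by nra. nra.
Qed.

(* Expanding [1/(e^y-1)] as a geometric series and integrating termwise. *)
Definition boseP (K : nat) (y : R) : R :=
  - psum (fun i => exp (- (INR i * y)) * (y / INR i + 1 / INR i ^ 2)) K.

Lemma boseP_derive_sum (K : nat) (y : R) :
  is_derive (boseP K) y (psum (fun i => y * exp (- (INR i * y))) K).
Proof.
  rewrite <- (Ropp_involutive (psum _ K)).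
  unfold boseP; apply (is_derive_opp (fun y => psum _ K)).
  induction K as [| K IH].
  - replace (- psum _ 0) with 0 by (simpl; ring); apply (is_derive_const 0).
  - apply is_derive_ext with
      (fun y => psum (fun i => exp (- (INR i * y)) * (y / INR i + 1 / INR i ^ 2)) K
        + exp (- (INR (S K) * y)) * (y / INR (S K) + 1 / INR (S K) ^ 2)); [reflexivity |].
    rewrite psum_succ, Ropp_plus_distr.
    apply (is_derive_plus (fun y => psum _ K) (fun y => _ * _)); auto.
    assert (hk : 0 < INR (S K)) by (apply lt_0_INR; lia).
    set (c := INR (S K)) in *; auto_derive; [auto |]; field; lra.
Qed.

(** The truncated geometric series falls short of [bose y] by the factor [1 - exp (- K y)]. Hence
    [boseP K] is a primitive from below, as [riemann_sum_ge] requires; from above a correction will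
    be added. *)
Lemma bose_partial_sum (K : nat) (y : R) : 0 < y ->
  psum (fun i => y * exp (- (INR i * y))) K = bose y * (1 - exp (- (INR K * y))).
Proof.
  intros hy; generalize (exp_sub1_pos y hy); intros he.
  unfold bose; induction K as [| K IH].
  - simpl; rewrite Rmult_0_l, Ropp_0, exp_0; field; lra.
  - rewrite psum_succ, IH.
    rewrite S_INR; replace (- ((INR K + 1) * y)) with (- (INR K * y) + - y) by ring.
    rewrite exp_plus, (exp_Ropp y); field; split; [lra |]. generalize (exp_pos y); lra.
Qed.

Lemma boseP_derive (K : nat) (y : R) : 0 < y ->
  is_derive (boseP K) y (bose y * (1 - exp (- (INR K * y)))).
Proof. intros hy; rewrite <- bose_partial_sum by auto; apply boseP_derive_sum. Qed.

Lemma boseP_le_0 (K : nat) (y : R) : 0 < y -> boseP K y <= 0.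
Proof.
  intros hy; unfold boseP.
  enough (0 <= psum (fun i => exp (- (INR i * y)) * (y / INR i + 1 / INR i ^ 2)) K) by lra.
  apply psum_nonneg; intros i hi.
  assert (0 < INR i) by (apply lt_0_INR; lia).
  apply Rmult_le_pos; [left; apply exp_pos |].
  apply Rplus_le_le_0_compat; apply Rdiv_le_0_compat; try lra; apply pow_lt; lra.
Qed.

(** Uniform in [K]. This bound controls the far end of the Riemann sum, where [boseP] tends to [0];
    [boseP_ge_small] and [boseP_le_small] control its start, where the Basel sum appears. *)
Lemma boseP_ge_large (K : nat) (y : R) : 0 < y -> - (2 / y) <= boseP K y.
Proof.
  intros hy; unfold boseP.
  enough (psum (fun i => exp (- (INR i * y)) * (y / INR i + 1 / INR i ^ 2)) K <= 2 / y) by lra.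
  apply Rle_trans with (psum (fun i => (y + 1) * exp (- y) ^ i) K).
  - apply psum_le; intros i hi.
    assert (h1 : 1 <= INR i) by (apply (le_INR 1); lia).
    replace (exp (- y) ^ i) with (exp (- (INR i * y)))
      by (rewrite <- Rpower_pow by apply exp_pos; unfold Rpower; rewrite ln_exp; f_equal; ring).
    rewrite Rmult_comm; apply Rmult_le_compat_r; [left; apply exp_pos |].
    apply Rplus_le_compat; apply Rle_div_l; nra.
  - rewrite psum_scal.
    generalize (exp_ge_quadratic y ltac:(lra)); intros he.
    assert (hz : exp (- y) < 1) by (rewrite <- exp_0; apply exp_increasing; lra).
    apply Rle_trans with ((y + 1) * (exp (- y) / (1 - exp (- y)))).
    + apply Rmult_le_compat_l; [lra |]; apply psum_geometric.
      split; [left; apply exp_pos | auto].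
    + rewrite exp_Ropp in *; generalize (exp_pos y) (exp_sub1_pos y hy); intros h1 h2.
      replace ((y + 1) * (/ exp y / (1 - / exp y))) with ((y + 1) / (exp y - 1))
        by (field; split; lra).
      apply Rle_div_l; auto.
      replace (2 / y * (exp y - 1)) with (2 * (exp y - 1) / y) by (field; lra).
      apply Rle_div_r; nra.
Qed.

Lemma boseP_ge_small (K : nat) (y : R) : 0 < y -> - (PI ^ 2 / 6) <= boseP K y.
Proof.
  intros hy.
  apply Rle_trans with (- psum (fun i => 1 / INR i ^ 2) K);
    [generalize (basel_bound K); lra |].
  unfold boseP; apply Ropp_le_contravar, psum_le; intros i hi.
  assert (h1 : 0 < INR i) by (apply lt_0_INR; lia).
  replace (y / INR i + 1 / INR i ^ 2) with ((1 + INR i * y) * (1 / INR i ^ 2)) by (field; lra).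
  apply Rle_trans with (1 * (1 / INR i ^ 2)); [rewrite <- Rmult_assoc | lra].
  apply Rmult_le_compat_r; [apply Rdiv_le_0_compat; [lra | apply pow_lt; auto] |].
  rewrite exp_Ropp; generalize (exp_pos (INR i * y)) (exp_ineq1_le (INR i * y)); intros.
  apply Rmult_le_reg_l with (exp (INR i * y)); auto; rewrite <- Rmult_assoc, Rinv_r; lra.
Qed.

Lemma exp_neg_in_01 (y : R) : 0 <= y -> 0 < exp (- y) <= 1.
Proof.
  intros hy; split; [apply exp_pos |]; rewrite <- exp_0.
  destruct (Req_dec y 0) as [-> | h]; [rewrite Ropp_0; lra |].
  left; apply exp_increasing; lra.
Qed.

Lemma boseP_le_small (K : nat) (y : R) : 0 < y ->
  boseP K y <= - (PI ^ 2 / 6) + 4 / (INR K + 1) + y.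
Proof.
  intros hy.
  assert (h0 : boseP K 0 = - psum (fun i => 1 / INR i ^ 2) K).
  { unfold boseP; f_equal; apply psum_ext; intros i hi.
    rewrite Rmult_0_r, Ropp_0, exp_0; unfold Rdiv; ring. }
  generalize (basel_bound K); intros hb.
  enough (0 * (y - 0) <= boseP K y - boseP K 0 <= 1 * (y - 0)) by lra.
  apply (mean_value_between (boseP K) (fun y => psum (fun i => y * exp (- (INR i * y))) K));
    [lra | intros; apply boseP_derive_sum |].
  intros x [hx _]; destruct hx as [hx | <-].
  - rewrite bose_partial_sum by auto.
    generalize (bose_bounds x hx) (exp_neg_in_01 (INR K * x)) (pos_INR K); intros h1 h2 h3.
    specialize (h2 ltac:(nra)); nra.
  - rewrite (psum_scal 0); lra.
Qed.

Lemma exists_small_inv (e : R) : 0 < e -> exists K : nat, (1 <= K)%nat /\ 4 / INR K < e.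
Proof.
  intros he; destruct (INR_unbounded (4 / e + 1)) as [K hK]; exists K.
  assert (0 < 4 / e) by (apply Rdiv_lt_0_compat; lra).
  assert (h : 1 < INR K) by lra. split.
  - apply INR_le; simpl; lra.
  - apply Rlt_div_l; [lra |]. apply (Rmult_lt_reg_l (/ e)); [apply Rinv_0_lt_compat; auto |].
    rewrite <- Rmult_assoc, Rinv_l by lra. unfold Rdiv in *; lra.
Qed.

Lemma four_div_succ (K : nat) : (1 <= K)%nat -> 0 < 4 / (INR K + 1) <= 4 / INR K.
Proof.
  intros h; apply (le_INR 1) in h; simpl in h; split; [apply Rdiv_lt_0_compat; lra |].
  apply Rmult_le_compat_l; [lra |]; apply Rinv_le_contravar; lra.
Qed.

(** The hypothesis on [p] pushes the last sample point beyond [1 / a], where [boseP] is within [2 a]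
    of its limit [0]. The constant is [5 = 2 + 2 + 1]: the far end, the uncovered interval
    [[0, 2a]], and the truncation at [K]. *)
Lemma bose_sum (a : R) (p : nat) : 0 < a -> 1 <= INR p * a ^ 2 ->
  Rabs (psum (fun i => a * bose (INR (S i) * a)) p - PI ^ 2 / 6) <= 5 * a.
Proof.
  intros ha hp; apply Rabs_le; split.
  - destruct (exists_small_inv a ha) as [K [hK1 hK2]].
    generalize (four_div_succ K hK1); intros hK3.
    generalize (riemann_sum_ge bose (boseP K) _ a ha bose_decr (boseP_derive K) p); intros h.
    specialize (h ltac:(intros x hx; generalize (bose_bounds x hx)
      (exp_pos (- (INR K * x))); nra)).
    cbv beta in h; rewrite plus_INR in h; change (INR 2) with (1 + 1) in h.
    assert (hy : 1 / a <= (INR p + (1 + 1)) * a) by (apply Rle_div_l; nra).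
    assert (hy' : 0 < 1 / a) by (apply Rdiv_lt_0_compat; lra).
    generalize (boseP_ge_large K ((INR p + (1 + 1)) * a) ltac:(lra))
      (boseP_le_small K (2 * a) ltac:(lra)); intros h1 h2.
    assert (2 / ((INR p + (1 + 1)) * a) <= 2 * a).
    { apply Rle_div_l; [lra |]. nra. }
    lra.
  - apply le_epsilon; intros e he.
    destruct (exists_small_inv e he) as [K [hK1 hK2]].
    assert (hK : 1 <= INR K) by (apply (le_INR 1); auto).
    (* The extra term [- exp (- K y) / K] has derivative [exp (- K y)], which makes up for the
       truncation because [bose <= 1]; its cost, at most [1 / K], is absorbed by [e]. *)
    generalize (riemann_sum_le bose (fun y => boseP K y - exp (- (INR K * y)) / INR K)
      (fun y => bose y * (1 - exp (- (INR K * y))) + exp (- (INR K * y))) a ha bose_decr); intros h.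
    assert (hd : forall x, 0 < x -> is_derive (fun y => boseP K y - exp (- (INR K * y)) / INR K) x
        (bose x * (1 - exp (- (INR K * x))) + exp (- (INR K * x)))).
    { intros x hx.
      replace (bose x * (1 - exp (- (INR K * x))) + exp (- (INR K * x)))
       with (bose x * (1 - exp (- (INR K * x))) - (- exp (- (INR K * x)))) by ring.
      apply (is_derive_minus (boseP K) (fun y => exp (- (INR K * y)) / INR K));
        [now apply boseP_derive | auto_derive; auto; field; lra]. }
    specialize (h hd p ltac:(intros x hx; generalize (bose_bounds x hx)
      (exp_pos (- (INR K * x))); nra)).
    cbv beta in h.
    assert (hpp : 0 < INR (p + 1) * a) by (apply Rmult_lt_0_compat; auto; apply lt_0_INR; lia).
    generalize (boseP_le_0 K (INR (p + 1) * a) hpp) (boseP_ge_small K a ha)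
      (exp_neg_in_01 (INR K * a) ltac:(nra)) (exp_neg_in_01 (INR K * (INR (p + 1) * a)) ltac:(nra)).
    intros h1 h2 h3 h4.
    assert (hi : 0 < / INR K) by (apply Rinv_0_lt_compat; lra).
    unfold Rdiv in *. nra.
Qed.

(** The identity [(y bose y)' = 2 bose y - bose2 y] reduces everything to the primitive of [bose],
    and doubles the value [PI^2 / 6]. The boundary term [y bose y] is small at both ends. *)
Lemma bose2_sum (a : R) (p : nat) : 0 < a -> 1 <= INR p * a ^ 2 ->
  Rabs (psum (fun i => a * bose2 (INR (S i) * a)) p - PI ^ 2 / 3) <= 17 * a.
Proof.
  intros ha hp.
  assert (hdb : forall x, 0 < x -> is_derive (fun y => y * bose y) x (2 * bose x - bose2 x)).
  { intros x hx; unfold bose, bose2; generalize (exp_sub1_pos x hx); intros.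
    auto_derive; [lra | field; lra]. }
  apply Rabs_le; split.
  - destruct (exists_small_inv a ha) as [K [hK1 hK2]].
    generalize (four_div_succ K hK1); intros hK3.
    generalize (riemann_sum_ge bose2 (fun y => 2 * boseP K y - y * bose y)
      (fun y => 2 * (bose y * (1 - exp (- (INR K * y)))) - (2 * bose y - bose2 y)) a ha bose2_decr);
      intros h.
    assert (hd : forall x, 0 < x -> is_derive (fun y => 2 * boseP K y - y * bose y) x
       (2 * (bose x * (1 - exp (- (INR K * x)))) - (2 * bose x - bose2 x))).
    { intros x hx; apply (is_derive_minus (fun y => 2 * boseP K y) (fun y => y * bose y)); auto.
      apply is_derive_scal, boseP_derive; auto. }
    specialize (h hd p ltac:(intros x hx; generalize (bose_bounds x hx)
      (exp_pos (- (INR K * x))); nra)).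
    cbv beta in h; rewrite plus_INR in h; change (INR 2) with (1 + 1) in h.
    assert (hy : 1 / a <= (INR p + (1 + 1)) * a) by (apply Rle_div_l; nra).
    assert (hy' : 0 < 1 / a) by (apply Rdiv_lt_0_compat; lra).
    set (Y := (INR p + (1 + 1)) * a) in *.
    generalize (boseP_ge_large K Y ltac:(lra))
      (boseP_le_small K (2 * a) ltac:(lra)) (bose_bounds (2 * a) ltac:(lra)); intros h1 h2 h3.
    assert (hq : 1 / Y <= a).
    { apply Rle_div_l; [lra |]. apply (proj1 (Rle_div_l 1 Y a ha)) in hy; lra. }
    (* The cubic Taylor term of [exp] is needed here: it gives [Y^2 / (exp Y - 1)] a decay of order
       [1 / Y]. *)
    assert (hY : Y * bose Y <= 6 / Y).
    { unfold bose; assert (hy3 : 0 < Y) by lra.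
      assert (he : 1 + Y + Y ^ 2 / 2 + Y ^ 3 / 6 <= exp Y) by
       (apply exp_ge_cubic; lra).
      replace (Y * (Y / (exp Y - 1))) with (Y ^ 2 / (exp Y - 1)) by (unfold Rdiv; ring).
      apply Rle_div_l; [apply exp_sub1_pos; auto |].
      replace (6 / Y * (exp Y - 1)) with (6 * (exp Y - 1) / Y) by (field; lra).
      apply (Rle_div_r (Y ^ 2) _ Y hy3). nra. }
    unfold Rdiv in *. nra.
  - apply le_epsilon; intros e he.
    destruct (exists_small_inv e he) as [K [hK1 hK2]].
    assert (hK : 1 <= INR K) by (apply (le_INR 1); auto).
    generalize (riemann_sum_le bose2 (fun y => 2 * (boseP K y - exp (- (INR K * y)) / INR K) - y * bose y)
      (fun y => 2 * (bose y * (1 - exp (- (INR K * y))) + exp (- (INR K * y)))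
         - (2 * bose y - bose2 y)) a ha bose2_decr); intros h.
    assert (hd : forall x, 0 < x ->
        is_derive (fun y => 2 * (boseP K y - exp (- (INR K * y)) / INR K) - y * bose y) x
        (2 * (bose x * (1 - exp (- (INR K * x))) + exp (- (INR K * x))) - (2 * bose x - bose2 x))).
    { intros x hx.
      apply (is_derive_minus (fun y => 2 * (boseP K y - exp (- (INR K * y)) / INR K))
               (fun y => y * bose y)); auto.
      apply (is_derive_scal (fun y => boseP K y - exp (- (INR K * y)) / INR K)).
      replace (bose x * (1 - exp (- (INR K * x))) + exp (- (INR K * x)))
       with (bose x * (1 - exp (- (INR K * x))) - (- exp (- (INR K * x)))) by ring.
      apply (is_derive_minus (boseP K) (fun y => exp (- (INR K * y)) / INR K));
        [now apply boseP_derive | auto_derive; auto; field; lra]. }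
    specialize (h hd p ltac:(intros x hx; generalize (bose_bounds x hx)
      (exp_pos (- (INR K * x))); nra)).
    cbv beta in h.
    assert (hpp : 0 < INR (p + 1) * a) by (apply Rmult_lt_0_compat; auto; apply lt_0_INR; lia).
    generalize (boseP_le_0 K (INR (p + 1) * a) hpp) (boseP_ge_small K a ha)
      (exp_neg_in_01 (INR K * a) ltac:(nra)) (exp_neg_in_01 (INR K * (INR (p + 1) * a)) ltac:(nra))
      (bose_bounds a ha) (bose_bounds _ hpp).
    intros h1 h2 h3 h4 h5 h6.
    assert (hi : 0 < / INR K) by (apply Rinv_0_lt_compat; lra).
    assert (0 < INR (p + 1) * a * bose (INR (p + 1) * a)) by nra.
    unfold Rdiv in *. nra.
Qed.

(** * The generating function on the circle *)

(* [|1 - x e^{iy}|^2 = (1 - x)^2 (1 + modq x y)]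
   and [phase x y] is the argument of [1 / (1 - x e^{iy})]. *)
Definition modq (x y : R) : R := 2 * x * (1 - cos y) / (1 - x) ^ 2.
Definition phase (x y : R) : R := atan (x * sin y / (1 - x * cos y)).

Lemma modq_nonneg (x y : R) : 0 < x < 1 -> 0 <= modq x y.
Proof.
  intros hx; unfold modq; apply Rdiv_le_0_compat; [| apply pow_lt; lra].
  generalize (COS_bound y); nra.
Qed.

Lemma ln_one_add_le (u : R) : 0 <= u -> ln (1 + u) <= u.
Proof.
  intros h; rewrite <- (ln_exp u) at 2; apply ln_le; [lra | apply exp_ineq1_le].
Qed.

Lemma ln_one_add_ge (u : R) : 0 <= u -> u - u ^ 2 / 2 <= ln (1 + u).
Proof.
  intros hu.
  enough (ln (1 + 0) - (0 - 0 ^ 2 / 2) <= ln (1 + u) - (u - u ^ 2 / 2)) as h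
    by (rewrite Rplus_0_r, ln_1 in h; lra).
  apply (nondecreasing_of_derive (fun u => ln (1 + u) - (u - u ^ 2 / 2))
           (fun u => u ^ 2 / (1 + u))); auto.
  - intros t ht; auto_derive; [lra | field; lra].
  - intros t ht; apply Rdiv_le_0_compat; [apply pow2_ge_0 | lra].
Qed.

Lemma ln_modq_approx (x y : R) : 0 < x < 1 -> 0 <= y ->
  Rabs (ln (1 + modq x y) - x * y ^ 2 / (1 - x) ^ 2)
  <= x * y ^ 4 / (1 - x) ^ 2 + (x * y ^ 2 / (1 - x) ^ 2) ^ 2.
Proof.
  intros hx hy.
  generalize (modq_nonneg x y hx); intros h0.
  generalize (ln_one_add_le _ h0) (ln_one_add_ge _ h0); intros h1 h2.
  assert (hd : 0 < x / (1 - x) ^ 2) by (apply Rdiv_lt_0_compat; [| apply pow_lt]; lra).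
  set (d := x / (1 - x) ^ 2) in *.
  replace (x * y ^ 2 / (1 - x) ^ 2) with (d * y ^ 2) by (unfold d; field; lra).
  replace (x * y ^ 4 / (1 - x) ^ 2) with (d * y ^ 4) by (unfold d; field; lra).
  assert (e : modq x y = d * (2 * (1 - cos y))) by (unfold modq, d; field; lra).
  rewrite e in *.
  generalize (one_sub_cos_le y hy) (one_sub_cos_ge y hy); intros h3 h4.
  assert (h5 : 0 <= y ^ 4) by (apply pow_le; lra).
  assert (h6 : d * (2 * (1 - cos y)) <= d * y ^ 2) by (apply Rmult_le_compat_l; lra).
  assert (h7 : d * (y ^ 2 - y ^ 4 / 12) <= d * (2 * (1 - cos y))) by (apply Rmult_le_compat_l; lra).
  assert (h8 : 0 <= d * y ^ 4) by (apply Rmult_le_pos; lra).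
  assert (h9 : (d * (2 * (1 - cos y))) ^ 2 <= (d * y ^ 2) ^ 2) by (apply pow_incr; lra).
  assert (h10 : 0 <= (d * y ^ 2) ^ 2) by apply pow2_ge_0.
  apply Rabs_le; lra.
Qed.

(** The derivative of the phase differs from its value [x / (1 - x)] at [0] by a nonpositive
    multiple of [1 - cos t], so the error is quadratic before integration and cubic after it. *)
Lemma phase_approx (x y : R) : 0 < x < 1 -> 0 <= y ->
  Rabs (phase x y - y * x / (1 - x)) <= x * y ^ 3 / (1 - x) ^ 3.
Proof.
  intros hx hy.
  assert (hc : forall t, 0 < 1 - x * cos t) by (intros t; generalize (COS_bound t); nra).
  assert (hn : forall t, (1 - x) ^ 2 <= 1 - 2 * x * cos t + x ^ 2)
    by (intros t; generalize (COS_bound t); nra).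
  assert (h1x : 0 < (1 - x) ^ 2) by (apply pow_lt; lra).
  generalize (mean_value_between (fun t => phase x t - t * x / (1 - x))
    (fun t => - (x * (1 + x) * (1 - cos t)) / ((1 - x) * (1 - 2 * x * cos t + x ^ 2)))
    (- (x * y ^ 2 / (1 - x) ^ 3)) 0 0 y hy); intros h.
  assert (e0 : phase x 0 = 0)
    by (unfold phase; rewrite sin_0, Rmult_0_r; unfold Rdiv; rewrite Rmult_0_l; apply atan_0).
  cbv beta in h; rewrite e0 in h.
  replace (0 * x / (1 - x)) with 0 in h by (field; lra).
  replace (x * y ^ 3 / (1 - x) ^ 3) with (x * y ^ 2 / (1 - x) ^ 3 * y) by (field; lra).
  enough (hh : - (x * y ^ 2 / (1 - x) ^ 3) * (y - 0) <=
    phase x y - y * x / (1 - x) - (0 - 0) <= 0 * (y - 0)).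
  { assert (0 <= x * y ^ 2 / (1 - x) ^ 3 * y).
    { apply Rmult_le_pos; auto; apply Rdiv_le_0_compat; [nra | apply pow_lt; lra]. }
    apply Rabs_le; lra. }
  apply h.
  - intros t _; unfold phase.
    generalize (hc t) (hn t); intros hct hnt.
    assert (e2 : (1 - x * cos t) ^ 2 + (x * sin t) ^ 2 = 1 - 2 * x * cos t + x ^ 2).
    { generalize (sin2_cos2 t); unfold Rsqr; intros e.
      replace ((1 - x * cos t) ^ 2 + (x * sin t) ^ 2)
        with (1 - 2 * x * cos t + x ^ 2 * (sin t * sin t + cos t * cos t)) by ring.
      rewrite e; ring. }
    auto_derive; [repeat split; lra |].
    generalize (sin2_cos2 t); unfold Rsqr; intros e.
    replace (x ^ 2) with (x * x) in * by ring.
    apply Rminus_diag_uniq.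
    replace (1 + (x * sin t * / (1 - x * cos t)) ^ 2)
      with ((1 - 2 * x * cos t + x * x) / (1 - x * cos t) ^ 2) by (rewrite <- e2; field; lra).
    field_simplify_eq.
    + replace (sin t ^ 2) with (1 - cos t ^ 2) by (simpl; lra); ring.
    + repeat split; lra.
  - intros t ht.
    generalize (hn t) (COS_bound t) (one_sub_cos_le t (proj1 ht)); intros h1 h2 h3.
    assert (h4 : 0 <= x * (1 + x) * (1 - cos t)) by (apply Rmult_le_pos; nra).
    assert (h5 : x * (1 + x) * (1 - cos t) <= x * y ^ 2).
    { replace (x * (1 + x) * (1 - cos t)) with (x * ((1 + x) * (1 - cos t))) by ring.
      apply Rmult_le_compat_l; [lra |]. nra. }
    assert (h6 : 0 <= x * (1 + x) * (1 - cos t) / ((1 - x) * (1 - 2 * x * cos t + x ^ 2))).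
    { apply Rdiv_le_0_compat; auto; apply Rmult_lt_0_compat; lra. }
    unfold Rdiv in *; rewrite Ropp_mult_distr_l_reverse; split; [| lra].
    apply Ropp_le_contravar, Rmult_le_compat; auto.
    + left; apply Rinv_0_lt_compat, Rmult_lt_0_compat; lra.
    + apply Rinv_le_contravar; [apply pow_lt; lra |].
      replace ((1 - x) ^ 3) with ((1 - x) * (1 - x) ^ 2) by ring.
      apply Rmult_le_compat_l; lra.
Qed.

(** Used with [v = j a] for the part [j]. Bounding [v / (1 - x)] by [1 + v] removes the singularity
    at [v = 0]; half of the exponential then absorbs the polynomial, since [1 + v <= 8 exp (v / 8)]
    and [8^4 = 4096]. The other half makes the sum over [j] of size [1 / a]. *)
Lemma exp_weight_bounds (v x : R) : 0 < v -> x = exp (- v) ->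
  0 < x < 1 /\
  v ^ 4 * (x / (1 - x) ^ 2) <= 4096 * exp (- (v / 2)) /\
  v ^ 4 * (x / (1 - x) ^ 2) ^ 2 <= 4096 * exp (- (v / 2)) /\
  v ^ 3 * (x / (1 - x) ^ 3) <= 4096 * exp (- (v / 2)).
Proof.
  intros hv e.
  assert (hx : 0 < x < 1).
  { rewrite e; split; [apply exp_pos |]; rewrite <- exp_0; apply exp_increasing; lra. }
  split; auto.
  set (w := v / (1 - x)).
  assert (hw : 0 < w <= 1 + v).
  { split; [apply Rdiv_lt_0_compat; lra |].
    apply Rle_div_l; [lra |].
    enough (x * (1 + v) <= 1) by lra.
    rewrite e, exp_Ropp; generalize (exp_pos v) (exp_ineq1_le v); intros.
    apply Rmult_le_reg_l with (exp v); auto.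
    rewrite <- Rmult_assoc, Rinv_r; lra. }
  assert (hp : (1 + v) ^ 4 * x <= 4096 * exp (- (v / 2))).
  { rewrite e; replace (exp (- v)) with (exp (- (v / 2)) * exp (- (v / 2)))
      by (rewrite <- exp_plus; f_equal; field).
    rewrite <- Rmult_assoc; apply Rmult_le_compat_r; [left; apply exp_pos |].
    rewrite exp_Ropp; apply Rle_div_l; [apply exp_pos |].
    replace (exp (v / 2)) with (exp (v / 8) ^ 4)
      by (rewrite <- Rpower_pow by apply exp_pos; unfold Rpower; rewrite ln_exp;
          f_equal; simpl; field).
    apply Rle_trans with ((8 * (1 + v / 8)) ^ 4); [apply pow_incr; lra |].
    rewrite Rpow_mult_distr.
    replace (8 ^ 4) with 4096 by ring; apply Rmult_le_compat_l; [lra |].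
    apply pow_incr; generalize (exp_ineq1_le (v / 8)); lra. }
  assert (h2 : w ^ 2 <= (1 + v) ^ 2) by (apply pow_incr; lra).
  assert (h3 : w ^ 3 <= (1 + v) ^ 3) by (apply pow_incr; lra).
  assert (h4 : w ^ 4 <= (1 + v) ^ 4) by (apply pow_incr; lra).
  assert (hv2 : v ^ 2 <= (1 + v) ^ 2) by (apply pow_incr; lra).
  repeat split.
  - replace (v ^ 4 * (x / (1 - x) ^ 2)) with (v ^ 2 * w ^ 2 * x) by (unfold w; field; lra).
    eapply Rle_trans; [| apply hp]; apply Rmult_le_compat_r; [lra |].
    replace ((1 + v) ^ 4) with ((1 + v) ^ 2 * (1 + v) ^ 2) by ring.
    apply Rmult_le_compat; auto; apply pow2_ge_0.
  - replace (v ^ 4 * (x / (1 - x) ^ 2) ^ 2) with (w ^ 4 * x * x) by (unfold w; field; lra).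
    eapply Rle_trans; [| apply hp].
    assert (0 <= w ^ 4) by (apply pow_le; lra). nra.
  - replace (v ^ 3 * (x / (1 - x) ^ 3)) with (w ^ 3 * x) by (unfold w; field; lra).
    eapply Rle_trans; [| apply hp]; apply Rmult_le_compat_r; [lra |].
    assert (0 <= (1 + v) ^ 3) by (apply pow_le; lra).
    replace ((1 + v) ^ 4) with ((1 + v) ^ 3 * (1 + v)) by ring. nra.
Qed.

(** As [psum] starts at 1, the index [i] stands for the part [i + 1], and part 1 is left out. *)
Definition xq (a : R) (i : nat) : R := exp (- (INR (S i) * a)).
(** [exp (logW a p th)] and [Phi a p th] are the modulus and the argument of the product of
    [(1 - x_j) / (1 - x_j e^{i j th})] over the parts [j = 2, ..., p + 1], with [x_j = e^{-j a}].
    The numerators normalise it to [1] at [th = 0]. *)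
Definition logW (a : R) (p : nat) (th : R) : R :=
  - / 2 * psum (fun i => ln (1 + modq (xq a i) (INR (S i) * th))) p.
Definition Phi (a : R) (p : nat) (th : R) : R :=
  psum (fun i => phase (xq a i) (INR (S i) * th)) p.

Lemma psum_half_exp_le (a : R) (p : nat) : 0 < a ->
  psum (fun i => exp (- (INR (S i) * a / 2))) p <= 2 / a.
Proof.
  intros ha; apply Rle_trans with (psum (fun i => exp (- (INR i * (a / 2)))) p).
  - apply psum_le; intros i hi.
    rewrite S_INR.
    left; apply exp_increasing; lra.
  - eapply Rle_trans; [apply psum_exp_le; lra |]. right; field; lra.
Qed.

Lemma INR_S_pos (i : nat) : 0 < INR (S i).
Proof. apply lt_0_INR; lia. Qed.

(** The coefficient [PI^2 / 6] is half of the limit in [bose2_sum]. On the scale [th = t a^(3/2)]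
    the right-hand side is [a] times a polynomial in [t]. *)
Lemma logW_approx (a th : R) (p : nat) : 0 < a -> 1 <= INR p * a ^ 2 -> 0 <= th ->
  Rabs (logW a p th + PI ^ 2 / 6 / a ^ 3 * th ^ 2)
  <= 8192 * th ^ 4 / a ^ 5 + 9 * th ^ 2 / a ^ 2.
Proof.
  intros ha hp hth.
  assert (h1 : Rabs (psum (fun i => ln (1 + modq (xq a i) (INR (S i) * th))) p
                     - th ^ 2 / a ^ 3 * psum (fun i => a * bose2 (INR (S i) * a)) p)
               <= 8192 * th ^ 4 / a ^ 4 * (2 / a)).
  { apply Rle_trans with
      (8192 * th ^ 4 / a ^ 4 * psum (fun i => exp (- (INR (S i) * a / 2))) p).
    - rewrite <- psum_sub_scal, <- psum_scal.
      apply psum_abs; intros i _.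
      generalize (INR_S_pos i); set (j := INR (S i)); intros hj.
      assert (hv : 0 < j * a) by nra.
      generalize (exp_weight_bounds (j * a) (xq a i) hv eq_refl); intros [hx [hb1 [hb2 _]]].
      generalize (ln_modq_approx (xq a i) (j * th) hx ltac:(nra)); intros hl.
      set (x := xq a i) in *.
      replace (th ^ 2 / a ^ 3 * (a * bose2 (j * a))) with (x * (j * th) ^ 2 / (1 - x) ^ 2).
      + eapply Rle_trans; [apply hl |].
        replace (x * (j * th) ^ 4 / (1 - x) ^ 2 + (x * (j * th) ^ 2 / (1 - x) ^ 2) ^ 2)
          with (th ^ 4 / a ^ 4 * ((j * a) ^ 4 * (x / (1 - x) ^ 2)
                + (j * a) ^ 4 * (x / (1 - x) ^ 2) ^ 2)) by (field; lra).
        replace (8192 * th ^ 4 / a ^ 4 * exp (- (j * a / 2)))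
          with (th ^ 4 / a ^ 4 * (8192 * exp (- (j * a / 2)))) by (field; lra).
        apply Rmult_le_compat_l; [| lra].
        apply Rdiv_le_0_compat; [apply pow_le | apply pow_lt]; lra.
      + unfold bose2, x, xq; rewrite exp_Ropp.
        change (INR (S i)) with j.
        generalize (exp_sub1_pos (j * a) hv) (exp_pos (j * a)); intros.
        field; repeat split; lra.
    - apply Rmult_le_compat_l; [| now apply psum_half_exp_le].
      apply Rdiv_le_0_compat; [| apply pow_lt; lra].
      assert (0 <= th ^ 4) by (apply pow_le; lra); lra. }
  generalize (bose2_sum a p ha hp); intros h2.
  unfold logW.
  set (S2 := psum (fun i => a * bose2 (INR (S i) * a)) p) in *; set (S1 := psum _ p) in *.
  replace (- / 2 * S1 + PI ^ 2 / 6 / a ^ 3 * th ^ 2) with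
    (- / 2 * (S1 - th ^ 2 / a ^ 3 * S2) - / 2 * (th ^ 2 / a ^ 3) * (S2 - PI ^ 2 / 3))
    by (field; lra).
  assert (hq : 0 <= th ^ 2 / a ^ 3) by (apply Rdiv_le_0_compat; [apply pow2_ge_0 | apply pow_lt; lra]).
  assert (h3 : Rabs (/ 2 * (th ^ 2 / a ^ 3) * (S2 - PI ^ 2 / 3)) <= / 2 * (th ^ 2 / a ^ 3) * (17 * a)).
  { rewrite Rabs_mult, (Rabs_pos_eq (/ 2 * _)) by lra; apply Rmult_le_compat_l; lra. }
  replace (8192 * th ^ 4 / a ^ 5) with (/ 2 * (8192 * th ^ 4 / a ^ 4 * (2 / a))) by (field; lra).
  replace (/ 2 * (th ^ 2 / a ^ 3) * (17 * a)) with (17 / 2 * (th ^ 2 / a ^ 2)) in h3 by (field; lra).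
  replace (9 * th ^ 2 / a ^ 2) with (9 * (th ^ 2 / a ^ 2)) by (unfold Rdiv; ring).
  assert (0 <= th ^ 2 / a ^ 2) by (apply Rdiv_le_0_compat; [apply pow2_ge_0 | apply pow_lt; lra]).
  apply Rabs_le_between in h1; apply Rabs_le_between in h3; apply Rabs_le; lra.
Qed.

(** On the scale [th = t a^(3/2)] the error is [sqrt a] times a polynomial in [t]; this is the size
    of the phase left after centring. *)
Lemma Phi_approx (a th : R) (p : nat) : 0 < a -> 1 <= INR p * a ^ 2 -> 0 <= th ->
  Rabs (Phi a p th - PI ^ 2 / 6 / a ^ 2 * th) <= 8192 * th ^ 3 / a ^ 4 + 5 * th / a.
Proof.
  intros ha hp hth.
  assert (h1 : Rabs (Phi a p th
                     - th / a ^ 2 * psum (fun i => a * bose (INR (S i) * a)) p)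
               <= 4096 * th ^ 3 / a ^ 3 * (2 / a)).
  { apply Rle_trans with
      (4096 * th ^ 3 / a ^ 3 * psum (fun i => exp (- (INR (S i) * a / 2))) p).
    - unfold Phi; rewrite <- psum_sub_scal, <- psum_scal.
      apply psum_abs; intros i _.
      generalize (INR_S_pos i); set (j := INR (S i)); intros hj.
      assert (hv : 0 < j * a) by nra.
      generalize (exp_weight_bounds (j * a) (xq a i) hv eq_refl); intros [hx [_ [_ hb]]].
      generalize (phase_approx (xq a i) (j * th) hx ltac:(nra)); intros hl.
      set (x := xq a i) in *.
      replace (th / a ^ 2 * (a * bose (j * a))) with (j * th * x / (1 - x)).
      + eapply Rle_trans; [apply hl |].
        replace (x * (j * th) ^ 3 / (1 - x) ^ 3)
          with (th ^ 3 / a ^ 3 * ((j * a) ^ 3 * (x / (1 - x) ^ 3))) by (field; lra).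
        replace (4096 * th ^ 3 / a ^ 3 * exp (- (j * a / 2)))
          with (th ^ 3 / a ^ 3 * (4096 * exp (- (j * a / 2)))) by (field; lra).
        apply Rmult_le_compat_l; [| lra].
        apply Rdiv_le_0_compat; [apply pow_le | apply pow_lt]; lra.
      + unfold bose, x, xq; rewrite exp_Ropp.
        change (INR (S i)) with j.
        generalize (exp_sub1_pos (j * a) hv) (exp_pos (j * a)); intros.
        field; repeat split; lra.
    - apply Rmult_le_compat_l; [| now apply psum_half_exp_le].
      apply Rdiv_le_0_compat; [| apply pow_lt; lra].
      assert (0 <= th ^ 3) by (apply pow_le; lra); lra. }
  generalize (bose_sum a p ha hp); intros h2.
  set (S2 := psum _ p) in *.
  replace (Phi a p th - PI ^ 2 / 6 / a ^ 2 * th) with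
    ((Phi a p th - th / a ^ 2 * S2) + th / a ^ 2 * (S2 - PI ^ 2 / 6)) by (field; lra).
  assert (hq : 0 <= th / a ^ 2) by (apply Rdiv_le_0_compat; [lra | apply pow_lt; lra]).
  assert (h3 : Rabs (th / a ^ 2 * (S2 - PI ^ 2 / 6)) <= th / a ^ 2 * (5 * a)).
  { rewrite Rabs_mult, (Rabs_pos_eq (th / a ^ 2)) by lra; apply Rmult_le_compat_l; lra. }
  replace (8192 * th ^ 3 / a ^ 4) with (4096 * th ^ 3 / a ^ 3 * (2 / a)) by (field; lra).
  replace (5 * th / a) with (th / a ^ 2 * (5 * a)) by (field; lra).
  eapply Rle_trans; [apply Rabs_triang | lra].
Qed.

Lemma xq_bounds (a : R) (i : nat) : 0 < a -> 0 < xq a i < 1.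
Proof.
  intros ha; unfold xq; split; [apply exp_pos |].
  rewrite <- exp_0; apply exp_increasing; generalize (INR_S_pos i); nra.
Qed.

(** * Decay of the modulus away from the positive axis *)

Lemma ln_modq_ge (x y : R) : 1 / 4 <= x < 1 -> (1 - cos y) / 4 <= ln (1 + modq x y).
Proof.
  intros hx; generalize (COS_bound y); intros hc.
  set (s := (1 - cos y) / 2).
  assert (hs : 0 <= s <= 1) by (unfold s; lra).
  apply Rle_trans with (ln (1 + s)).
  - generalize (ln_one_add_ge s (proj1 hs)); unfold s in *; nra.
  - apply ln_le; [lra |]; apply Rplus_le_compat_l.
    unfold modq, s; apply (Rle_div_r _ _ ((1 - x) ^ 2)); [apply pow_lt; lra |].
    assert ((1 - x) ^ 2 <= 1) by (simpl; nra). nra.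
Qed.

Lemma sum_cos_closed (th : R) (n : nat) :
  2 * sin (th / 2) * psum (fun i => cos (INR i * th)) n
  = sin (INR n * th + th / 2) - sin (th / 2).
Proof.
  induction n as [| n IH].
  - simpl; rewrite Rmult_0_l, Rplus_0_l; ring.
  - rewrite psum_succ, Rmult_plus_distr_l, IH, S_INR.
    replace (INR n * th + th / 2) with ((INR n + 1) * th - th / 2) by field.
    rewrite sin_minus, sin_plus; ring.
Qed.

(** By the Dirichlet kernel the cosines add up to at most [2 / th <= 2 J / PI], hence to at most two
    thirds of [J]. *)
Lemma sum_one_sub_cos_large (th : R) (J : nat) : 0 < th <= PI -> PI <= INR J * th ->
  INR J / 3 <= psum (fun i => 1 - cos (INR i * th)) J.
Proof.
  intros hth hJ.
  generalize (sin_ge_half (th / 2)) (sum_cos_closed th J) (SIN_bound (INR J * th + th / 2)) PI_gt_3.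
  intros h1 h2 h3 h4; specialize (h1 ltac:(lra)).
  assert (e : psum (fun i => 1 - cos (INR i * th)) J
              = INR J - psum (fun i => cos (INR i * th)) J).
  { clear; induction J as [| J IH]; [simpl; ring |].
    rewrite !psum_succ, IH, S_INR; ring. }
  rewrite e; set (c := psum _ J) in *.
  enough (c <= 2 * INR J / 3) by lra.
  assert (hj : 0 <= INR J) by apply pos_INR.
  destruct (Rle_lt_dec c 0); [lra |].
  assert (th / 2 * c <= 1) by nra.
  assert (c * PI <= 2 * INR J) by nra.
  nra.
Qed.

Lemma sum_squares (J : nat) :
  psum (fun i => INR i ^ 2) J = INR J * (INR J + 1) * (2 * INR J + 1) / 6.
Proof.
  induction J as [| J IH]; [simpl; field |].
  rewrite psum_succ, IH, S_INR; field.
Qed.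

(** The second summand on the left, from the lower-order term of the sum of squares, will pay for
    the absent part 1. *)
Lemma sum_one_sub_cos_small (th : R) (J : nat) : 0 <= th -> INR J * th <= PI ->
  th ^ 2 * INR J ^ 3 / 24 + th ^ 2 * INR J ^ 2 / 16 <= psum (fun i => 1 - cos (INR i * th)) J.
Proof.
  intros hth hJ.
  apply Rle_trans with (psum (fun i => th ^ 2 / 8 * INR i ^ 2) J).
  - rewrite psum_scal, sum_squares.
    generalize (pow2_ge_0 th) (pos_INR J); nra.
  - apply psum_le; intros i hi.
    assert (h1 : INR i <= INR J) by (apply le_INR; lia).
    generalize (pos_INR i); intros h0.
    generalize (one_sub_cos_ge_eighth (INR i * th) ltac:(nra)); nra.
Qed.

Lemma exists_floor_inv (a : R) : 0 < a -> exists J : nat, 1 / a - 1 < INR J <= 1 / a.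
Proof.
  intros ha; assert (hp : 0 < 1 / a) by (apply Rdiv_lt_0_compat; lra).
  destruct (nfloor_ex (1 / a)) as [J hJ]; [lra |]; exists J; lra.
Qed.

(** Dropping factors only increases the bound, so the parts [j <= J <= 1 / a] are enough; for them
    [x_j >= e^{-1} > 1/4], as [ln_modq_ge] wants. The correction [1 - cos th] accounts for the
    absent part 1. *)
Lemma logW_le_sum (a th : R) (p J : nat) : 0 < a -> (1 <= J <= p)%nat -> INR J * a <= 1 ->
  logW a p th <= - / 8 * (psum (fun i => 1 - cos (INR i * th)) J - (1 - cos th)).
Proof.
  intros ha hJ hJa; unfold logW.
  enough (psum (fun i => (1 - cos (INR (S i) * th)) / 4) (J - 1)
          <= psum (fun i => ln (1 + modq (xq a i) (INR (S i) * th))) p).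
  { assert (e : psum (fun i => (1 - cos (INR (S i) * th)) / 4) (J - 1)
      = / 4 * (psum (fun i => 1 - cos (INR i * th)) J - (1 - cos th))).
    { destruct J as [| J]; [lia |]; clear.
      replace (S J - 1)%nat with J by lia; induction J as [| J IH].
      - simpl; rewrite Rmult_1_l; ring.
      - rewrite psum_succ, IH, (psum_succ _ (S J)); field. }
    lra. }
  apply Rle_trans with (psum (fun i => ln (1 + modq (xq a i) (INR (S i) * th))) (J - 1)).
  - apply psum_le; intros i hi; apply ln_modq_ge.
    split; [| apply xq_bounds; auto].
    unfold xq; rewrite exp_Ropp.
    assert (h1 : INR (S i) <= INR J) by (apply le_INR; lia).
    assert (h2 : exp (INR (S i) * a) <= exp 1).
    { destruct (Req_dec (INR (S i) * a) 1) as [-> | h]; [lra |].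
      left; apply exp_increasing; nra. }
    generalize exp_le_3 (exp_pos (INR (S i) * a)); intros.
    unfold Rdiv; rewrite Rmult_1_l; apply Rinv_le_contravar; lra.
  - apply psum_mono; [lia |]; intros i hi.
    rewrite <- ln_1 at 1; apply ln_le; [lra |].
    generalize (modq_nonneg (xq a i) (INR (S i) * th) (xq_bounds a i ha)); lra.
Qed.

(** With [J] the integer part of [1 / a], the two cases are separated by [J th = PI]. In the first
    one [1536 = 8 * 24 * 2^3] combines the factor of [logW_le_sum], that of [sum_one_sub_cos_small],
    and [J >= 1 / (2 a)]. *)
Lemma logW_le (a th : R) (p : nat) : 0 < a <= 1 / 25 -> 1 <= INR p * a ^ 2 -> 0 <= th <= PI ->
  logW a p th <= - (th ^ 2 / a ^ 3) / 1536 \/ logW a p th <= - (1 / a) / 96.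
Proof.
  intros ha hp hth.
  destruct (exists_floor_inv a ltac:(lra)) as [J hJ].
  assert (hi : 25 <= 1 / a) by (apply Rle_div_r; lra).
  assert (hJa : INR J * a <= 1).
  { apply Rmult_le_reg_r with (1 / a); [lra |]. field_simplify; lra. }
  assert (hJp : (1 <= J <= p)%nat).
  { split; apply INR_le; [simpl; lra |].
    apply Rle_trans with (1 / a); [lra |]; apply Rle_div_l; [lra |].
    generalize (pos_INR p); nra. }
  generalize (logW_le_sum a th p J ltac:(lra) hJp hJa); intros hl.
  assert (hJ2 : 1 / a / 2 <= INR J) by lra.
  destruct (Rle_lt_dec (INR J * th) PI) as [h | h]; [left | right].
  - generalize (sum_one_sub_cos_small th J (proj1 hth) h) (one_sub_cos_le th (proj1 hth)); intros h1 h2.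
    assert (h3 : (1 / a / 2) ^ 3 <= INR J ^ 3) by (apply pow_incr; lra).
    replace (th ^ 2 / a ^ 3) with (8 * (th ^ 2 * (1 / a / 2) ^ 3)) by (field; lra).
    (* Here [J^2 / 16 >= 1/2] makes the lower-order term outweigh [1 - cos th <= th^2 / 2]. *)
    assert (h4 : 24 ^ 2 <= INR J ^ 2) by (apply pow_incr; lra).
    generalize (pow2_ge_0 th); intros h5. nra.
  - assert (0 < th) by (generalize PI_gt_3 (pos_INR J); nra).
    generalize (sum_one_sub_cos_large th J ltac:(lra) ltac:(lra)) (COS_bound th); intros h1 h2.
    lra.
Qed.

Lemma exp_le_compat (x y : R) : x <= y -> exp x <= exp y.
Proof. intros [h | ->]; [left; now apply exp_increasing | lra]. Qed.

(** The exponent [10 = 6 + 2 + 2] is the weight consumed later: six powers for [B^2], two for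
    [1 - cos th], and two for an integrable tail. *)
Lemma gaussian_pow_bound (c : R) : 0 < c -> exists K, 0 < K /\
  forall t, 0 <= t -> exp (- (c * t ^ 2)) * (1 + t) ^ 10 <= K.
Proof.
  intros hc.
  set (C := 10 * (1 + 1 / c)).
  assert (hc' : 0 < 1 / c) by (apply Rdiv_lt_0_compat; lra).
  exists (C ^ 5); split; [apply pow_lt; unfold C; lra |].
  intros t ht.
  apply Rmult_le_reg_l with (exp (c * t ^ 2)); [apply exp_pos |].
  rewrite <- Rmult_assoc, <- exp_plus, Rplus_opp_r, exp_0, Rmult_1_l.
  set (z := c * t ^ 2 / 5).
  replace (exp (c * t ^ 2)) with (exp z ^ 5)
    by (rewrite <- Rpower_pow by apply exp_pos; unfold Rpower; rewrite ln_exp;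
        f_equal; unfold z; simpl; field).
  rewrite <- Rpow_mult_distr.
  replace ((1 + t) ^ 10) with (((1 + t) ^ 2) ^ 5) by ring.
  apply pow_incr; split; [apply pow2_ge_0 |].
  apply Rle_trans with ((1 + z) * C).
  - replace ((1 + z) * C) with (10 + 10 / c + 2 * c * t ^ 2 + 2 * t ^ 2)
      by (unfold z, C; field; lra).
    assert (0 < 10 / c) by (apply Rdiv_lt_0_compat; lra).
    assert (0 <= c * t ^ 2) by (apply Rmult_le_pos; [lra | apply pow2_ge_0]).
    generalize (pow2_ge_0 (t - 1)); nra.
  - apply Rmult_le_compat_r; [unfold C; lra | generalize (exp_ineq1_le z); lra].
Qed.

(* [h = sqrt a], so that [th / h ^ 3] is the angle in units of the Gaussian width. *)
Lemma W_decay : exists K, 0 < K /\ forall (h th : R) (p : nat),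
  0 < h <= 1 / 5 -> 1 <= INR p * h ^ 4 -> 0 <= th <= PI ->
  exp (logW (h ^ 2) p th) * (1 + th / h ^ 3) ^ 10 <= K.
Proof.
  destruct (gaussian_pow_bound (1 / 1536) ltac:(lra)) as [K1 [hK1 hb]].
  (* In the second case of [logW_le] the weight is at most [(5 / h^3)^10 = 5^10 h^{-30}], as
     [PI < 4]. Since [h^{-30}] is [96^15] times the 15th power of [1 / (96 h^2)],
     [pow_div_fact_le_exp] absorbs it. *)
  set (K2 := 5 ^ 10 * (96 ^ 15 * INR 15 ^ 15)).
  assert (hK2 : 0 < K2).
  { unfold K2; apply Rmult_lt_0_compat; [| apply Rmult_lt_0_compat]; apply pow_lt;
      [lra | lra | apply lt_0_INR; lia]. }
  exists (K1 + K2); split; [lra |]; intros h th p hh hp hth.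
  assert (h2 : 0 < h ^ 2 <= 1 / 25) by (split; [apply pow_lt; lra | nra]).
  assert (h3 : 0 < h ^ 3) by (apply pow_lt; lra).
  set (t := th / h ^ 3).
  assert (ht : 0 <= t) by (apply Rdiv_le_0_compat; lra).
  assert (ht10 : 0 <= (1 + t) ^ 10) by (apply pow_le; lra).
  destruct (logW_le (h ^ 2) th p h2 ltac:(replace ((h ^ 2) ^ 2) with (h ^ 4) by ring; lra) hth)
    as [hl | hl].
  - apply Rle_trans with K1; [| lra].
    eapply Rle_trans; [| apply (hb t ht)].
    apply Rmult_le_compat_r; auto; apply exp_le_compat.
    eapply Rle_trans; [apply hl |]. right; unfold t; field; lra.
  - apply Rle_trans with K2; [| lra].
    apply Rle_trans with (exp (- (1 / h ^ 2 / 96)) * (5 / h ^ 3) ^ 10).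
    + apply Rmult_le_compat; auto; [left; apply exp_pos | apply exp_le_compat; lra |].
      apply pow_incr; split; [lra |].
      replace (5 / h ^ 3) with (1 / h ^ 3 + 4 / h ^ 3) by (field; lra).
      apply Rplus_le_compat.
      * apply (Rle_div_r 1 1 (h ^ 3)); [lra |]. assert (h ^ 3 <= 1 ^ 3) by (apply pow_incr; lra). lra.
      * unfold t; apply Rmult_le_compat_r; [left; now apply Rinv_0_lt_compat |].
        generalize PI_lt_16_5; lra.
    + assert (hi : 0 < 1 / h ^ 2) by (apply Rdiv_lt_0_compat; lra).
      generalize (pow_div_fact_le_exp 15 (1 / h ^ 2 / 96) ltac:(lra) ltac:(lia)); intros he.
      rewrite exp_Ropp.
      set (E := exp (1 / h ^ 2 / 96)) in *.
      assert (hE : 0 < E) by apply exp_pos.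
      apply Rmult_le_reg_l with E; auto.
      rewrite <- Rmult_assoc, Rinv_r, Rmult_1_l by lra.
      replace ((5 / h ^ 3) ^ 10) with (5 ^ 10 * (96 ^ 15 * (1 / h ^ 2 / 96) ^ 15)) by (field; lra).
      unfold K2.
      replace (E * (5 ^ 10 * (96 ^ 15 * INR 15 ^ 15)))
        with (5 ^ 10 * (96 ^ 15 * (INR 15 ^ 15 * E))) by ring.
      apply Rmult_le_compat_l; [apply pow_le; lra |].
      apply Rmult_le_compat_l; [apply pow_le; lra | apply he].
Qed.

(** * Fourier inversion *)

Lemma zsum_ext (l : list nat) (f g : nat -> Z) :
  (forall i, In i l -> f i = g i) -> zsum l f = zsum l g.
Proof.
  induction l as [| x l IH]; intros h; simpl; auto.
  rewrite (h x), IH; simpl; auto. intros i hi; apply h; simpl; auto.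
Qed.

Lemma zsum_cons (x : nat) (l : list nat) (f : nat -> Z) :
  zsum (x :: l) f = (f x + zsum l f)%Z.
Proof. reflexivity. Qed.

Lemma zsum_map (l : list nat) (s : nat -> nat) (f : nat -> Z) :
  zsum (map s l) f = zsum l (fun i => f (s i)).
Proof. induction l as [| x l IH]; simpl; [| rewrite IH]; auto. Qed.

(** Case distinction on whether the part [S j] occurs; this replaces the sum over its multiplicity,
    with its division, by a one-step recurrence. *)
Lemma pp_succ (j n : nat) :
  pp (S j) n = (pp j n + (if (n <? S j)%nat then 0 else pp (S j) (n - S j)))%Z.
Proof.
  change (pp (S j) n) with (zsum (seq 0 (S (n / S j))) (fun i => pp j (n - i * S j))).
  rewrite <- cons_seq, zsum_cons, Nat.mul_0_l, Nat.sub_0_r.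
  f_equal.
  destruct (Nat.ltb_spec n (S j)) as [h | h].
  - rewrite Nat.div_small by auto; reflexivity.
  - change (pp (S j) (n - S j)) with
      (zsum (seq 0 (S ((n - S j) / S j))) (fun i => pp j (n - S j - i * S j))).
    rewrite <- seq_shift, zsum_map.
    replace (n / S j)%nat with (S ((n - S j) / S j)).
    + apply zsum_ext; intros i _; f_equal; lia.
    + replace n with ((n - S j) + 1 * S j)%nat at 2 by lia.
      rewrite Nat.div_add by lia; lia.
Qed.

Lemma pp_one (n : nat) : pp 1 n = 1%Z.
Proof.
  induction n as [| n IH]; [reflexivity |].
  rewrite pp_succ; simpl Nat.ltb; cbv iota.
  replace (S n - 1)%nat with n by lia; rewrite IH; reflexivity.
Qed.

(** Extension by zero to negative arguments, so that the recurrences hold on all of [Z] without side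
    conditions. *)
Definition ppz (j : nat) (z : Z) : Z := if (z <? 0)%Z then 0%Z else pp j (Z.to_nat z).

Lemma ppz_neg (j : nat) (z : Z) : (z < 0)%Z -> ppz j z = 0%Z.
Proof. intros h; unfold ppz; destruct (Z.ltb_spec z 0); lia. Qed.

Lemma ppz_succ (j : nat) (z : Z) :
  ppz (S j) z = (ppz j z + ppz (S j) (z - Z.of_nat (S j)))%Z.
Proof.
  unfold ppz; destruct (Z.ltb_spec z 0) as [h | h].
  - destruct (Z.ltb_spec (z - Z.of_nat (S j)) 0); lia.
  - rewrite pp_succ; f_equal.
    destruct (Nat.ltb_spec (Z.to_nat z) (S j)); destruct (Z.ltb_spec (z - Z.of_nat (S j)) 0); try lia.
    f_equal; lia.
Qed.

(* Partitions of [z] into parts between [2] and [p + 1]. *)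
Definition qz (p : nat) (z : Z) : Z := (ppz (S p) z - ppz (S p) (z - 1))%Z.

Lemma qz_succ (p : nat) (z : Z) :
  qz (S p) z = (qz p z + qz (S p) (z - Z.of_nat (S (S p))))%Z.
Proof.
  unfold qz; rewrite (ppz_succ (S p) z), (ppz_succ (S p) (z - 1)).
  replace (z - 1 - Z.of_nat (S (S p)))%Z with (z - Z.of_nat (S (S p)) - 1)%Z by lia; lia.
Qed.

Lemma qz_neg (p : nat) (z : Z) : (z < 0)%Z -> qz p z = 0%Z.
Proof. intros h; unfold qz; rewrite !ppz_neg by lia; lia. Qed.

Lemma qz_0 (z : Z) : qz 0 z = if (z =? 0)%Z then 1%Z else 0%Z.
Proof.
  unfold qz, ppz; rewrite !pp_one.
  destruct (Z.ltb_spec z 0); destruct (Z.ltb_spec (z - 1) 0); destruct (Z.eqb_spec z 0); lia.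
Qed.

Fixpoint qprod (a : R) (p : nat) : R :=
  match p with O => 1 | S p' => qprod a p' * (1 - xq a p) end.

Lemma qprod_pos (a : R) (p : nat) : 0 < a -> 0 < qprod a p.
Proof.
  intros ha; induction p as [| p IH]; simpl; [lra |].
  apply Rmult_lt_0_compat; auto; generalize (xq_bounds a (S p) ha); lra.
Qed.

(** Real part of the normalised product times [e^{- i z th}]. By the symmetry in [th], half of the
    circle suffices. *)
Definition fourier (a : R) (p : nat) (z th : R) : R :=
  exp (logW a p th) * cos (Phi a p th - z * th).

Lemma logW_succ (a : R) (p : nat) (th : R) :
  logW a (S p) th = logW a p th + - / 2 * ln (1 + modq (xq a (S p)) (INR (S (S p)) * th)).
Proof. unfold logW; rewrite psum_succ; ring. Qed.

Lemma Phi_succ (a : R) (p : nat) (th : R) :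
  Phi a (S p) th = Phi a p th + phase (xq a (S p)) (INR (S (S p)) * th).
Proof. reflexivity. Qed.

Lemma exp_neg_half_ln (u : R) : 0 < u -> exp (- / 2 * ln u) = / sqrt u.
Proof.
  intros h; replace (- / 2 * ln u) with (- (/ 2 * ln u)) by ring.
  rewrite exp_Ropp; f_equal; rewrite <- Rpower_sqrt by auto; reflexivity.
Qed.

(** Real part of [e^{i psi}] times [(1 - x) / (1 - x e^{i y})] times [1 - x e^{i y}], with the
    middle factor written through its modulus and its argument [phase x y]. *)
Lemma euler_factor (x y psi : R) : 0 < x < 1 ->
  exp (- / 2 * ln (1 + modq x y)) *
    (cos (psi + phase x y) - x * cos (psi + phase x y + y)) = (1 - x) * cos psi.
Proof.
  intros hx.
  generalize (modq_nonneg x y hx); intros hu.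
  rewrite exp_neg_half_ln by lra.
  set (s := sqrt (1 + modq x y)).
  assert (hs : 0 < s) by (apply sqrt_lt_R0; lra).
  assert (hd : 0 < 1 - x * cos y) by (generalize (COS_bound y); nra).
  set (d := 1 - x * cos y) in *; set (c := x * sin y).
  assert (e : d ^ 2 + c ^ 2 = ((1 - x) * s) ^ 2).
  { rewrite Rpow_mult_distr; unfold s; rewrite pow2_sqrt by lra.
    unfold modq, d, c; generalize (sin2_cos2 y); unfold Rsqr; intros e.
    replace ((1 - x * cos y) ^ 2 + (x * sin y) ^ 2)
      with (1 - 2 * x * cos y + x ^ 2 * (sin y * sin y + cos y * cos y)) by ring.
    rewrite e; field; lra. }
  assert (er : sqrt (1 + (c / d)²) = (1 - x) * s / d).
  { replace (1 + (c / d)²) with (((1 - x) * s / d) ^ 2).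
    - apply sqrt_pow2, Rdiv_le_0_compat; [apply Rmult_le_pos |]; lra.
    - unfold Rdiv; rewrite (Rpow_mult_distr (_ * s)), <- e; unfold Rsqr; field; lra. }
  assert (ec : cos (phase x y) = d / ((1 - x) * s)).
  { unfold phase; fold c d; rewrite cos_atan, er; field; lra. }
  assert (es : sin (phase x y) = c / ((1 - x) * s)).
  { unfold phase; fold c d; rewrite sin_atan, er; field; lra. }
  replace (psi + phase x y + y) with ((psi + y) + phase x y) by ring.
  rewrite !cos_plus, ec, es, sin_plus.
  transitivity ((cos psi * (d * (1 - x * cos y) + c * (x * sin y))
     - sin psi * (c * (1 - x * cos y) - d * (x * sin y))) / ((1 - x) * s ^ 2)); [field; lra |].
  fold d c.
  replace (d * d + c * c) with (((1 - x) * s) ^ 2) by (rewrite <- e; ring).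
  field; lra.
Qed.

(** The counterpart of [qz_succ] for the integrand: multiplying by the factor [1 - x e^{i y}]
    removes the part [p + 2] from the product. *)
Lemma fourier_succ (a : R) (p : nat) (z th : R) : 0 < a ->
  1 * fourier a (S p) z th + - xq a (S p) * fourier a (S p) (z - INR (S (S p))) th
  = (1 - xq a (S p)) * fourier a p z th.
Proof.
  intros ha; unfold fourier; rewrite logW_succ, Phi_succ, exp_plus.
  set (y := INR (S (S p)) * th); set (x := xq a (S p)).
  generalize (euler_factor x y (Phi a p th - z * th) (xq_bounds a (S p) ha)).
  replace (Phi a p th + phase x y - z * th) with (Phi a p th - z * th + phase x y) by ring.
  replace (Phi a p th + phase x y - (z - INR (S (S p))) * th)
    with (Phi a p th - z * th + phase x y + y) by (unfold y; ring).
  intros e; transitivity (exp (logW a p th) * ((1 - x) * cos (Phi a p th - z * th)));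
    [rewrite <- e; ring | ring].
Qed.

Lemma logW_ex_derive (a : R) (p : nat) (th : R) : 0 < a -> ex_derive (logW a p) th.
Proof.
  intros ha; apply (ex_derive_scal (fun th => psum _ p)).
  induction p as [| p IH]; [exists 0; apply (is_derive_const (K := R_AbsRing) (V := R_NormedModule) 0) |].
  apply (ex_derive_plus (fun th => psum _ p)
    (fun th => ln (1 + modq (xq a (S p)) (INR (S (S p)) * th)))); auto.
  generalize (modq_nonneg (xq a (S p)) (INR (S (S p)) * th) (xq_bounds a (S p) ha))
    (xq_bounds a (S p) ha); set (x := xq a (S p)); set (j := INR (S (S p))); unfold modq; intros h hx.
  assert (h' : 0 <= 2 * x * (1 + - cos (j * th)) * / ((1 - x) * ((1 - x) * 1))) by exact h.
  auto_derive; lra.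
Qed.

Lemma Phi_ex_derive (a : R) (p : nat) (th : R) : 0 < a -> ex_derive (Phi a p) th.
Proof.
  intros ha; induction p as [| p IH]; [exists 0; apply (is_derive_const (K := R_AbsRing) (V := R_NormedModule) 0) |].
  apply (ex_derive_plus (Phi a p) (fun th => phase (xq a (S p)) (INR (S (S p)) * th))); auto.
  generalize (COS_bound (INR (S (S p)) * th)) (xq_bounds a (S p) ha);
    set (x := xq a (S p)); set (j := INR (S (S p))); intros h hx.
  unfold phase; auto_derive; repeat split; auto; nra.
Qed.

Lemma fourier_ex_derive (a : R) (p : nat) (z th : R) : 0 < a -> ex_derive (fourier a p z) th.
Proof.
  intros ha; unfold fourier.
  generalize (logW_ex_derive a p th ha) (Phi_ex_derive a p th ha); intros h1 h2.
  set (f := logW a p) in *; set (g := Phi a p) in *; auto_derive; auto.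
Qed.

Lemma fourier_ex_RInt (a : R) (p : nat) (z u v : R) : 0 < a -> ex_RInt (fourier a p z) u v.
Proof.
  intros ha; apply ex_RInt_of_continuous; intros x; apply continuous_of_ex_derive.
  now apply fourier_ex_derive.
Qed.

Definition fcoef (a : R) (p : nat) (z : R) : R := RInt (fourier a p z) 0 PI.

Lemma fcoef_succ (a : R) (p : nat) (z : R) : 0 < a ->
  fcoef a (S p) z = xq a (S p) * fcoef a (S p) (z - INR (S (S p))) + (1 - xq a (S p)) * fcoef a p z.
Proof.
  intros ha; unfold fcoef.
  assert (e : RInt (fun th => (1 - xq a (S p)) * fourier a p z th + 0 * fourier a p z th) 0 PI
     = RInt (fun th => 1 * fourier a (S p) z th
                + - xq a (S p) * fourier a (S p) (z - INR (S (S p))) th) 0 PI).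
  { apply (RInt_ext (V := R_CompleteNormedModule)); intros th _; rewrite fourier_succ by auto; simpl; ring. }
  rewrite !RInt_lin in e by now apply fourier_ex_RInt. lra.
Qed.

Lemma logW_le_0 (a : R) (p : nat) (th : R) : 0 < a -> logW a p th <= 0.
Proof.
  intros ha; unfold logW.
  enough (0 <= psum (fun i => ln (1 + modq (xq a i) (INR (S i) * th))) p) by lra.
  apply psum_nonneg; intros i _; rewrite <- ln_1; apply ln_le; [lra |].
  generalize (modq_nonneg (xq a i) (INR (S i) * th) (xq_bounds a i ha)); lra.
Qed.

Lemma fcoef_bound (a : R) (p : nat) (z : R) : 0 < a -> Rabs (fcoef a p z) <= PI.
Proof.
  intros ha; generalize PI_gt_3; intros hpi.
  apply Rle_trans with (RInt (fun _ => 1) 0 PI).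
  2: { right; rewrite (RInt_const (V := R_CompleteNormedModule)).
       unfold scal; simpl; unfold mult; simpl; ring. }
  apply Rabs_RInt_le; [lra | now apply fourier_ex_RInt | apply ex_RInt_const |].
  intros th _; unfold fourier.
  rewrite Rabs_mult, (Rabs_pos_eq (exp _)) by (left; apply exp_pos).
  assert (h1 : exp (logW a p th) <= 1).
  { rewrite <- exp_0; apply exp_le_compat; now apply logW_le_0. }
  assert (h2 : Rabs (cos (Phi a p th - z * th)) <= 1)
    by (apply Rabs_le; apply COS_bound).
  generalize (exp_pos (logW a p th)) (Rabs_pos (cos (Phi a p th - z * th))); nra.
Qed.

Lemma sin_IZR_PI (z : Z) : sin (IZR z * PI) = 0.
Proof. apply sin_eq_0_1; exists z; reflexivity. Qed.

Lemma fcoef_0 (a : R) (z : Z) : fcoef a 0 (IZR z) = if (z =? 0)%Z then PI else 0.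
Proof.
  assert (e : forall th, fourier a 0 (IZR z) th = cos (IZR z * th)).
  { intros th; unfold fourier, logW, Phi; simpl.
    rewrite Rmult_0_r, exp_0, Rmult_1_l, <- cos_neg; f_equal; ring. }
  unfold fcoef; rewrite (RInt_ext (V := R_CompleteNormedModule) _ (fun th => cos (IZR z * th)))
    by (intros; apply e).
  apply (is_RInt_unique (V := R_CompleteNormedModule)).
  destruct (Z.eqb_spec z 0) as [-> | h].
  - apply (is_RInt_ext (V := R_NormedModule) (fun _ => 1)).
    + intros x _; simpl; rewrite Rmult_0_l, cos_0; reflexivity.
    + replace PI with (PI - 0) at 2 by ring.
      apply (is_RInt_of_primitive (fun x => x)).
      * intros x; auto_derive; auto.
      * intros x; apply continuous_const.
  - apply not_0_IZR in h.
    replace 0 with (sin (IZR z * PI) / IZR z - sin (IZR z * 0) / IZR z) at 2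
      by (rewrite sin_IZR_PI, Rmult_0_r, sin_0; field; auto).
    apply (is_RInt_of_primitive (fun x => sin (IZR z * x) / IZR z)).
    + intros x; auto_derive; auto; field; auto.
    + intros x; apply continuous_of_ex_derive; auto_derive; auto.
Qed.

(** No power series is multiplied out. Both sides obey the same recurrence, so by induction on [p]
    their difference satisfies [E z = x E (z - (p + 2))]. Far to the left the count vanishes and the
    integral is bounded by [PI], whence [|E z| <= x^k PI] for all large [k], and [E z = 0]. *)
Lemma fcoef_eq (a : R) (p : nat) (z : Z) : 0 < a ->
  fcoef a p (IZR z) = PI * (IZR (qz p z) * exp (- (a * IZR z)) * qprod a p).
Proof.
  intros ha; revert z; induction p as [| p IH]; intros z.
  - rewrite fcoef_0, qz_0; simpl.
    destruct (Z.eqb_spec z 0) as [-> | h]; simpl; [rewrite Rmult_0_r, Ropp_0, exp_0 |]; ring.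
  - set (x := xq a (S p)).
    generalize (xq_bounds a (S p) ha); fold x; intros hx.
    set (E := fun z : Z => fcoef a (S p) (IZR z)
                - PI * (IZR (qz (S p) z) * exp (- (a * IZR z)) * qprod a (S p))).
    assert (hE : forall z, E z = x * E (z - Z.of_nat (S (S p)))%Z).
    { clear z; intros z; unfold E; rewrite fcoef_succ by auto; rewrite IH, (qz_succ p z), plus_IZR.
      rewrite minus_IZR, <- INR_IZR_INZ.
      simpl qprod; fold x.
      replace (exp (- (a * (IZR z - INR (S (S p)))))) with (exp (- (a * IZR z)) / x).
      - field; lra.
      - unfold x, xq, Rdiv; rewrite <- exp_Ropp, <- exp_plus; f_equal; ring. }
    assert (hk : forall k z, E z = x ^ k * E (z - Z.of_nat k * Z.of_nat (S (S p)))%Z).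
    { clear z; induction k as [| k IHk]; intros z.
      - simpl; rewrite Z.sub_0_r; ring.
      - rewrite hE, IHk; simpl pow; rewrite Rmult_assoc; do 3 f_equal; lia. }
    assert (hb : forall k, (z < Z.of_nat k)%Z -> Rabs (E z) <= x ^ k * PI).
    { intros k hz; rewrite (hk k z), Rabs_mult, (Rabs_pos_eq (x ^ k)) by (apply pow_le; lra).
      apply Rmult_le_compat_l; [apply pow_le; lra |].
      unfold E; rewrite qz_neg by nia.
      rewrite !Rmult_0_l, Rmult_0_r, Rminus_0_r; now apply fcoef_bound. }
    enough (E z = 0) by (unfold E in *; lra).
    destruct (Req_dec (E z) 0) as [h | h]; auto; exfalso.
    apply Rabs_pos_lt in h; generalize PI_gt_3; intros hpi.
    destruct (pow_lt_1_zero x ltac:(rewrite Rabs_pos_eq; lra) (Rabs (E z) / PI)) as [N hN];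
      [apply Rdiv_lt_0_compat; lra |].
    specialize (hN (Nat.max N (S (Z.to_nat z))) ltac:(lia)).
    specialize (hb (Nat.max N (S (Z.to_nat z))) ltac:(lia)).
    set (k := Nat.max _ _) in *.
    rewrite Rabs_pos_eq in hN by (apply pow_le; lra).
    apply (Rmult_lt_compat_r PI) in hN; [| lra].
    replace (Rabs (E z) / PI * PI) with (Rabs (E z)) in hN by (field; lra). lra.
Qed.

(** * Gaussian approximation *)

Lemma Rabs_exp_sub_le (x y : R) : Rabs (exp x - exp y) <= Rabs (x - y) * (exp x + exp y).
Proof.
  assert (h : forall u v, u <= v -> exp v - exp u <= (v - u) * exp v).
  { intros u v huv; replace u with (v + - (v - u)) at 1 by ring.
    rewrite exp_plus; generalize (exp_ineq1_le (- (v - u))) (exp_pos v); nra. }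
  generalize (exp_pos x) (exp_pos y); intros hx hy.
  destruct (Rle_lt_dec x y) as [hxy | hxy].
  - generalize (h x y hxy) (exp_le_compat x y hxy); intros.
    rewrite !Rabs_left1 by lra; nra.
  - generalize (h y x ltac:(lra)) (exp_le_compat y x ltac:(lra)); intros.
    rewrite !Rabs_pos_eq by lra; nra.
Qed.

Lemma one_sub_cos_abs (x : R) : 0 <= 1 - cos x <= x ^ 2 / 2.
Proof.
  split; [generalize (COS_bound x); lra |].
  destruct (Rle_lt_dec 0 x) as [h | h]; [now apply one_sub_cos_le |].
  rewrite <- cos_neg; replace (x ^ 2) with ((- x) ^ 2) by ring; apply one_sub_cos_le; lra.
Qed.

Lemma Rabs_sin_le (x : R) : Rabs (sin x) <= Rabs x.
Proof.
  assert (h : forall x, 0 <= x -> Rabs (sin x) <= x).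
  { clear; intros x hx.
    assert (forall t, 0 <= t -> sin t <= t).
    { intros t ht; destruct (Req_dec t 0) as [-> | h]; [rewrite sin_0; lra |].
      left; apply sin_lt_x; lra. }
    destruct (Rle_lt_dec x PI) as [h | h].
    - rewrite Rabs_pos_eq by (apply sin_ge_0; lra); auto.
    - apply Rle_trans with 1; [apply Rabs_le, SIN_bound | generalize PI_gt_3; lra]. }
  destruct (Rle_lt_dec 0 x) as [hx | hx].
  - rewrite (Rabs_pos_eq x) by lra; auto.
  - rewrite <- Rabs_Ropp, <- sin_neg, (Rabs_left x) by lra; apply h; lra.
Qed.

Section Pointwise.
Variables K0 K1 K2 h u w g B : R.
Hypothesis hh : 0 < h <= 1.
Hypothesis hu : 1 <= u.
Hypothesis hw : 0 <= w.
Hypothesis hg : 0 <= g.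
Hypothesis hwu : w * u ^ 10 <= K0.
Hypothesis hgu : g * u ^ 10 <= K0.
Hypothesis hwg : Rabs (w - g) * u ^ 6 <= K1 * h ^ 2.
Hypothesis hB : Rabs B <= K2 * h * u ^ 3.
Let th := h ^ 3 * (u - 1).

(** Here [u = 1 + th / h^3] measures the angle in Gaussian widths, [w] is the modulus, [g] the
    Gaussian and [B] the centred phase. The cosine turns [B = O(h u^3)] into [O(h^2 u^6)], which
    spends six of the ten powers of [u]. *)
Lemma pw_main : Rabs (w * cos B - g) * u ^ 4 <= (K1 + K0 * K2 ^ 2) * h ^ 2.
Proof.
  assert (h4 : 0 < u ^ 4) by (apply pow_lt; lra).
  assert (h64 : u ^ 4 <= u ^ 6) by (apply Rle_pow; [lra | lia]).
  apply Rle_trans with ((Rabs (w - g) + w * (1 - cos B)) * u ^ 4).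
  - apply Rmult_le_compat_r; [lra |].
    replace (w * cos B - g) with ((w - g) + - (w * (1 - cos B))) by ring.
    eapply Rle_trans; [apply Rabs_triang |].
    apply Rplus_le_compat_l; rewrite Rabs_Ropp, Rabs_pos_eq; [lra |].
    apply Rmult_le_pos; [auto | apply one_sub_cos_abs].
  - assert (hB2 : B ^ 2 <= (K2 * h * u ^ 3) ^ 2).
    { rewrite <- (pow2_abs B); apply pow_incr; split; [apply Rabs_pos | auto]. }
    assert (hc : 1 - cos B <= K2 ^ 2 * h ^ 2 * u ^ 6).
    { replace (K2 ^ 2 * h ^ 2 * u ^ 6) with ((K2 * h * u ^ 3) ^ 2) by ring.
      generalize (one_sub_cos_abs B) (pow2_ge_0 B); lra. }
    assert (h1 : w * (1 - cos B) * u ^ 4 <= w * (K2 ^ 2 * h ^ 2 * u ^ 6) * u ^ 4).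
    { apply Rmult_le_compat_r; [lra |]; apply Rmult_le_compat_l; auto. }
    assert (h2 : w * u ^ 10 * (K2 ^ 2 * h ^ 2) <= K0 * (K2 ^ 2 * h ^ 2)).
    { apply Rmult_le_compat_r; auto; apply Rmult_le_pos; apply pow2_ge_0. }
    assert (h3 : Rabs (w - g) * u ^ 4 <= Rabs (w - g) * u ^ 6).
    { apply Rmult_le_compat_l; [apply Rabs_pos | auto]. }
    replace (w * (K2 ^ 2 * h ^ 2 * u ^ 6) * u ^ 4) with (w * u ^ 10 * (K2 ^ 2 * h ^ 2)) in h1 by ring.
    rewrite Rmult_plus_distr_r; lra.
Qed.

Lemma pw_th : 0 <= th <= h ^ 3 * u.
Proof.
  assert (0 < h ^ 3) by (apply pow_lt; lra). unfold th; split; nra.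
Qed.

Lemma pw_second :
  Rabs (w * cos B * (1 - cos th) - g * (th ^ 2 / 2)) * u ^ 2 <= (K1 + K0 * K2 ^ 2 + K0) * h ^ 8.
Proof.
  generalize pw_main pw_th; intros hm ht.
  assert (h2 : 0 < u ^ 2) by (apply pow_lt; lra).
  assert (ht2 : th ^ 2 <= h ^ 6 * u ^ 2).
  { replace (h ^ 6 * u ^ 2) with ((h ^ 3 * u) ^ 2) by ring; apply pow_incr; lra. }
  assert (ht4 : th ^ 4 <= h ^ 8 * u ^ 4).
  { apply Rle_trans with ((h ^ 3 * u) ^ 4); [apply pow_incr; lra |].
    replace ((h ^ 3 * u) ^ 4) with (h ^ 4 * (h ^ 8 * u ^ 4)) by ring.
    assert (h ^ 4 <= 1 ^ 4) by (apply pow_incr; lra).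
    assert (0 <= h ^ 8 * u ^ 4) by (apply Rmult_le_pos; apply pow_le; lra).
    nra. }
  generalize (one_sub_cos_abs th) (one_sub_cos_ge th (proj1 ht)); intros hc1 hc2.
  apply Rle_trans with ((Rabs (w * cos B - g) * (h ^ 6 * u ^ 2) + g * (h ^ 8 * u ^ 4)) * u ^ 2).
  - apply Rmult_le_compat_r; [lra |].
    replace (w * cos B * (1 - cos th) - g * (th ^ 2 / 2))
      with ((w * cos B - g) * (1 - cos th) + - (g * (th ^ 2 / 2 - (1 - cos th)))) by ring.
    eapply Rle_trans; [apply Rabs_triang |].
    apply Rplus_le_compat.
    + rewrite Rabs_mult; apply Rmult_le_compat_l; [apply Rabs_pos |].
      rewrite Rabs_pos_eq by lra. generalize (pow2_ge_0 th); lra.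
    + rewrite Rabs_Ropp, Rabs_pos_eq by (apply Rmult_le_pos; lra).
      apply Rmult_le_compat_l; auto.
      assert (0 <= th ^ 4) by (apply pow_le; lra). lra.
  - assert (hm' : Rabs (w * cos B - g) * u ^ 4 * h ^ 6 <= (K1 + K0 * K2 ^ 2) * h ^ 2 * h ^ 6)
      by (apply Rmult_le_compat_r; auto; apply pow_le; lra).
    assert (hg6 : g * u ^ 6 <= K0).
    { eapply Rle_trans; [| apply hgu]; apply Rmult_le_compat_l; auto; apply Rle_pow; [lra | lia]. }
    assert (hg8 : g * u ^ 6 * h ^ 8 <= K0 * h ^ 8)
      by (apply Rmult_le_compat_r; auto; apply pow_le; lra).
    replace ((Rabs (w * cos B - g) * (h ^ 6 * u ^ 2) + g * (h ^ 8 * u ^ 4)) * u ^ 2)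
      with (Rabs (w * cos B - g) * u ^ 4 * h ^ 6 + g * u ^ 6 * h ^ 8) by ring.
    replace ((K1 + K0 * K2 ^ 2 + K0) * h ^ 8) with
      ((K1 + K0 * K2 ^ 2) * h ^ 2 * h ^ 6 + K0 * h ^ 8) by ring. lra.
Qed.

(** The first power of [B] gives one factor [h] and [sin th] gives [h^3]; nothing better is
    available, nor required. *)
Lemma pw_odd : Rabs (w * (sin B * sin th)) * u ^ 2 <= K0 * K2 * h ^ 4.
Proof.
  generalize pw_th (Rabs_sin_le B) (Rabs_sin_le th); intros ht hs1 hs2.
  rewrite (Rabs_pos_eq th) in hs2 by lra.
  assert (hb0 : 0 <= K2 * h * u ^ 3) by (eapply Rle_trans; [apply Rabs_pos | apply hB]).
  assert (hk2 : 0 <= K2).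
  { assert (0 < h * u ^ 3) by (apply Rmult_lt_0_compat; [| apply pow_lt]; lra). nra. }
  rewrite Rabs_mult, Rabs_mult, (Rabs_pos_eq w) by auto.
  apply Rle_trans with (w * ((K2 * h * u ^ 3) * (h ^ 3 * u)) * u ^ 2).
  - apply Rmult_le_compat_r; [apply pow_le; lra |]; apply Rmult_le_compat_l; auto.
    apply Rmult_le_compat; try apply Rabs_pos; lra.
  - replace (w * ((K2 * h * u ^ 3) * (h ^ 3 * u)) * u ^ 2) with (w * u ^ 6 * (K2 * h ^ 4)) by ring.
    rewrite (Rmult_assoc K0); apply Rmult_le_compat_r.
    + apply Rmult_le_pos; auto; apply pow_le; lra.
    + eapply Rle_trans; [| apply hwu]; apply Rmult_le_compat_l; auto; apply Rle_pow; [lra | lia].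
Qed.
End Pointwise.

Lemma continuous_quadratic_tail (c x : R) : 0 < c -> 0 <= x ->
  continuous (fun th => 1 / (1 + th / c) ^ 2) x.
Proof.
  intros hc hx; apply continuous_of_ex_derive; auto_derive.
  assert (0 <= x / c) by (apply Rdiv_le_0_compat; lra).
  unfold Rdiv in *; apply Rgt_not_eq; nra.
Qed.

Lemma ex_RInt_quadratic_tail (c : R) : 0 < c ->
  ex_RInt (fun th => 1 / (1 + th / c) ^ 2) 0 PI.
Proof.
  intros hc; apply (ex_RInt_continuous (V := R_CompleteNormedModule)).
  intros x hx; generalize PI_gt_3; intros; rewrite Rmin_left in hx by lra.
  apply continuous_quadratic_tail; lra.
Qed.

Lemma RInt_quadratic_tail_le (c : R) : 0 < c ->
  RInt (fun th => 1 / (1 + th / c) ^ 2) 0 PI <= c.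
Proof.
  intros hc; generalize PI_gt_3; intros hpi.
  rewrite (is_RInt_unique (V := R_CompleteNormedModule) _ _ _
    ((fun th => - c / (1 + th / c)) PI - (fun th => - c / (1 + th / c)) 0)).
  - cbv beta; assert (0 < PI / c) by (apply Rdiv_lt_0_compat; lra).
    assert (0 < c / (1 + PI / c)) by (apply Rdiv_lt_0_compat; lra).
    replace (- c / (1 + PI / c) - - c / (1 + 0 / c)) with (c - c / (1 + PI / c)) by (field; lra).
    lra.
  - apply (is_RInt_derive (V := R_CompleteNormedModule) (fun th => - c / (1 + th / c))).
    + intros x hx; rewrite Rmin_left in hx by lra.
      assert (0 <= x / c) by (apply Rdiv_le_0_compat; lra).
      auto_derive; [unfold Rdiv in *; lra | field; lra].
    + intros x hx; rewrite Rmin_left in hx by lra; apply continuous_quadratic_tail; lra.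
Qed.

(** Integration against [(1 + th / c)^{-2}] gains the width [c]; it is applied with [c = h^3]. *)
Lemma Rabs_RInt_tail_le (f : R -> R) (c E : R) : 0 < c ->
  ex_RInt f 0 PI -> (forall th, 0 <= th <= PI -> Rabs (f th) * (1 + th / c) ^ 2 <= E) ->
  Rabs (RInt f 0 PI) <= E * c.
Proof.
  intros hc hf hE; generalize PI_gt_3; intros hpi.
  assert (hE0 : 0 <= E).
  { eapply Rle_trans; [| apply (hE 0); lra].
    apply Rmult_le_pos; [apply Rabs_pos | apply pow2_ge_0]. }
  apply Rle_trans with
    (RInt (fun th => E * (1 / (1 + th / c) ^ 2) + 0 * (1 / (1 + th / c) ^ 2)) 0 PI).
  - apply Rabs_RInt_le; [lra | auto | |].
    + eexists; apply is_RInt_lin;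
        apply (RInt_correct (V := R_CompleteNormedModule)), ex_RInt_quadratic_tail; auto.
    + intros th hth; rewrite Rmult_0_l, Rplus_0_r.
      assert (0 <= th / c) by (apply Rdiv_le_0_compat; lra).
      replace (E * (1 / (1 + th / c) ^ 2)) with (E / (1 + th / c) ^ 2) by (field; lra).
      apply Rle_div_r; [apply pow_lt; lra | apply hE; lra].
  - rewrite RInt_lin by now apply ex_RInt_quadratic_tail.
    generalize (RInt_quadratic_tail_le c hc); intros; nra.
Qed.

Definition gauss (h th : R) : R := exp (- (PI ^ 2 / 6 / h ^ 6 * th ^ 2)).

Lemma gauss_ex_RInt (h u v : R) : 0 < h -> ex_RInt (gauss h) u v.
Proof.
  intros hh; apply ex_RInt_of_continuous; intros x; apply continuous_of_ex_derive.
  unfold gauss; auto_derive; auto.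
Qed.

Lemma gauss2_ex_RInt (h u v : R) : 0 < h -> ex_RInt (fun th => gauss h th * (th ^ 2 / 2)) u v.
Proof.
  intros hh; apply ex_RInt_of_continuous; intros x; apply continuous_of_ex_derive.
  unfold gauss; auto_derive; auto.
Qed.

(** Only the ratio of second moment to mass matters, so the Gaussian integral itself is never
    evaluated. The boundary term survives because the interval is finite. *)
Lemma gauss_parts (h : R) : 0 < h ->
  RInt (fun th => gauss h th * (th ^ 2 / 2)) 0 PI
  = 3 / (2 * PI ^ 2) * h ^ 6 * (RInt (gauss h) 0 PI - PI * gauss h PI).
Proof.
  intros hh; generalize PI_gt_3; intros hpi.
  assert (h6 : 0 < h ^ 6) by (apply pow_lt; lra).
  set (c := PI ^ 2 / 6 / h ^ 6).
  assert (e : is_RInt (fun th => 1 * gauss h th + - (4 * c) * (gauss h th * (th ^ 2 / 2))) 0 PI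
    (PI * gauss h PI - 0 * gauss h 0)).
  { apply (is_RInt_of_primitive (fun th => th * gauss h th)).
    - intros x; unfold gauss; fold c; auto_derive; auto; simpl pow; field.
    - intros x; unfold gauss; apply continuous_of_ex_derive; auto_derive; auto. }
  apply (is_RInt_unique (V := R_CompleteNormedModule)) in e.
  rewrite RInt_lin in e; [| now apply gauss_ex_RInt | now apply gauss2_ex_RInt].
  set (X := RInt (fun th => gauss h th * (th ^ 2 / 2)) 0 PI) in *.
  replace (RInt (gauss h) 0 PI - PI * gauss h PI) with (4 * c * X) by lra.
  assert (ef : forall x : R, x = 3 / (2 * PI ^ 2) * h ^ 6 * (4 * c * x))
    by (intros x; unfold c; field; lra).
  apply ef.
Qed.

(** Keep a single width [[0, h^3]], where the exponent is at most [PI^2 / 6 < 2]. *)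
Lemma gauss_mass_ge (h : R) : 0 < h <= 1 -> exp (-2) * h ^ 3 <= RInt (gauss h) 0 PI.
Proof.
  intros hh; generalize PI_gt_3 PI_lt_16_5; intros hpi hpi'.
  assert (h3 : 0 < h ^ 3 <= 1) by (split; [apply pow_lt; lra | replace 1 with (1 ^ 3) by ring; apply pow_incr; lra]).
  rewrite <- (RInt_Chasles (V := R_CompleteNormedModule) (gauss h) 0 (h ^ 3) PI)
    by (apply gauss_ex_RInt; lra).
  unfold plus; simpl plus.
  assert (h1 : 0 <= RInt (gauss h) (h ^ 3) PI).
  { apply RInt_ge_0; [lra | apply gauss_ex_RInt; lra | intros; left; apply exp_pos]. }
  assert (h2 : RInt (fun _ => exp (-2)) 0 (h ^ 3) <= RInt (gauss h) 0 (h ^ 3)).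
  { apply RInt_le; [lra | apply ex_RInt_const | apply gauss_ex_RInt; lra |].
    intros x hx; apply exp_le_compat.
    assert (hx2 : x ^ 2 <= (h ^ 3) ^ 2) by (apply pow_incr; lra).
    enough (PI ^ 2 / 6 / h ^ 6 * x ^ 2 <= 2) by lra.
    apply Rle_trans with (PI ^ 2 / 6 / h ^ 6 * (h ^ 3) ^ 2).
    - apply Rmult_le_compat_l; auto; apply Rdiv_le_0_compat; [nra | apply pow_lt; lra].
    - replace (PI ^ 2 / 6 / h ^ 6 * (h ^ 3) ^ 2) with (PI ^ 2 / 6) by (field; lra). nra. }
  rewrite (RInt_const (V := R_CompleteNormedModule)) in h2.
  unfold scal in h2; simpl in h2; unfold mult in h2; simpl in h2.
  change (exp (-2) * h ^ 3 <= RInt (gauss h) 0 (h ^ 3) + RInt (gauss h) (h ^ 3) PI).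
  simpl in *; lra.
Qed.

Lemma ln_one_add_approx (y : R) : - (1 / 2) <= y -> Rabs (ln (1 + y) - y) <= 2 * y ^ 2.
Proof.
  intros hy.
  assert (h1 : ln (1 + y) <= y).
  { rewrite <- (ln_exp y) at 2; apply ln_le; [lra | apply exp_ineq1_le]. }
  assert (h2 : y - 2 * y ^ 2 <= ln (1 + y)).
  { replace (ln (1 + y)) with (- ln (/ (1 + y))) by (rewrite ln_Rinv; lra).
    assert (h : ln (/ (1 + y)) <= / (1 + y) - 1).
    { rewrite <- (ln_exp (/ (1 + y) - 1)); apply ln_le; [apply Rinv_0_lt_compat; lra |].
      generalize (exp_ineq1_le (/ (1 + y) - 1)); lra. }
    enough (/ (1 + y) - 1 <= - y + 2 * y ^ 2) by lra.
    apply Rmult_le_reg_l with (1 + y); [lra |].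
    rewrite Rmult_minus_distr_l, Rinv_r by lra. nra. }
  apply Rabs_le; generalize (pow2_ge_0 y); lra.
Qed.

(** * Shifting the argument by one, and the second difference of the logarithm *)

Definition residual (a : R) (p : nat) (z th : R) : R := Phi a p th - z * th.

Definition even_part (a : R) (p : nat) (z : R) : R :=
  RInt (fun th => exp (logW a p th) * cos (residual a p z th) * (1 - cos th)) 0 PI.
Definition odd_part (a : R) (p : nat) (z : R) : R :=
  RInt (fun th => exp (logW a p th) * (sin (residual a p z th) * sin th)) 0 PI.

Lemma even_part_ex (a : R) (p : nat) (z : R) : 0 < a ->
  ex_RInt (fun th => exp (logW a p th) * cos (residual a p z th) * (1 - cos th)) 0 PI.
Proof.
  intros ha; apply ex_RInt_of_continuous; intros x; apply continuous_of_ex_derive.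
  generalize (logW_ex_derive a p x ha) (Phi_ex_derive a p x ha); intros h1 h2.
  unfold residual; set (f := logW a p) in *; set (g := Phi a p) in *; auto_derive; auto.
Qed.

Lemma odd_part_ex (a : R) (p : nat) (z : R) : 0 < a ->
  ex_RInt (fun th => exp (logW a p th) * (sin (residual a p z th) * sin th)) 0 PI.
Proof.
  intros ha; apply ex_RInt_of_continuous; intros x; apply continuous_of_ex_derive.
  generalize (logW_ex_derive a p x ha) (Phi_ex_derive a p x ha); intros h1 h2.
  unfold residual; set (f := logW a p) in *; set (g := Phi a p) in *; auto_derive; auto.
Qed.

Lemma fcoef_shift (a : R) (p : nat) (z e : R) : 0 < a -> e = 1 \/ e = -1 ->
  fcoef a p (z + e) = fcoef a p z - even_part a p z + e * odd_part a p z.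
Proof.
  intros ha he.
  set (f2 := fun th => exp (logW a p th) * cos (residual a p z th) * (1 - cos th)).
  set (f3 := fun th => exp (logW a p th) * (sin (residual a p z th) * sin th)).
  transitivity (RInt (fun th => 1 * (1 * fourier a p z th + -1 * f2 th) + e * f3 th) 0 PI).
  - apply (RInt_ext (V := R_CompleteNormedModule)); intros th _.
    unfold fourier, f2, f3, residual.
    replace (Phi a p th - (z + e) * th) with (Phi a p th - z * th - e * th) by ring.
    rewrite cos_minus.
    replace (cos (e * th)) with (cos th).
    2: { destruct he as [-> | ->]; [f_equal; ring | rewrite <- cos_neg; f_equal; ring]. }
    replace (sin (e * th)) with (e * sin th).
    2: { destruct he as [-> | ->]; [rewrite !Rmult_1_l; auto |].
         replace (-1 * th) with (- th) by ring; rewrite sin_neg; ring. }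
    simpl; ring.
  - rewrite RInt_lin; [rewrite RInt_lin | | now apply odd_part_ex].
    + unfold f2, f3; fold (even_part a p z) (odd_part a p z) (fcoef a p z); ring.
    + now apply fourier_ex_RInt.
    + now apply even_part_ex.
    + eexists; apply is_RInt_lin; apply (RInt_correct (V := R_CompleteNormedModule));
        [now apply fourier_ex_RInt | now apply even_part_ex].
Qed.

(** The Gaussian mass is at least a constant times [h^3], so relative to it the three bounds are of
    order [h^2], [h^8] and [h^4]. The point [z] may be off the saddle point by [K / h^2], since this
    changes the phase only by [O(h)] on the Gaussian scale. *)
Lemma integral_estimates (K : R) : 0 < K -> exists C, 0 < C /\
  forall (h z : R) (p : nat), 0 < h <= 1 / 5 -> 1 <= INR p * h ^ 4 ->
  Rabs (z - PI ^ 2 / 6 / h ^ 4) <= K / h ^ 2 ->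
  Rabs (fcoef (h ^ 2) p z - RInt (gauss h) 0 PI) <= C * h ^ 5 /\
  Rabs (even_part (h ^ 2) p z - 3 / (2 * PI ^ 2) * h ^ 6 * RInt (gauss h) 0 PI) <= C * h ^ 11 /\
  Rabs (odd_part (h ^ 2) p z) <= C * h ^ 7.
Proof.
  intros hK.
  destruct W_decay as [KW [hKW hW]].
  generalize PI_gt_3 PI_lt_16_5; intros hpi hpi'.
  destruct (gaussian_pow_bound (PI ^ 2 / 6)) as [KG [hKG hG]]; [nra |].
  set (K0 := KW + KG).
  (* [8201 = 8192 + 9] and [8197 = 8192 + 5] add up the coefficients in [logW_approx] and
     [Phi_approx], once every power of [t] is bounded by a power of [u]. *)
  set (K1 := 2 * K0 * 8201).
  set (K2 := 8197 + K).
  set (C := K1 + K0 * K2 ^ 2 + K0 + K0 * K2 + K0).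
  assert (hK0 : 0 < K0) by (unfold K0; lra).
  assert (hK2 : 0 < K2) by (unfold K2; lra).
  assert (hK1 : 0 < K1) by (unfold K1; lra).
  assert (hK22 : 0 < K0 * K2 ^ 2) by (apply Rmult_lt_0_compat; [| apply pow_lt]; lra).
  assert (hK02 : 0 < K0 * K2) by (apply Rmult_lt_0_compat; lra).
  exists C; split; [unfold C; lra |].
  intros h z p hh hp hz.
  assert (h1 : 0 < h <= 1) by lra.
  assert (ha : 0 < h ^ 2) by (apply pow_lt; lra).
  assert (h3 : 0 < h ^ 3) by (apply pow_lt; lra).
  assert (hp' : 1 <= INR p * (h ^ 2) ^ 2) by (replace ((h ^ 2) ^ 2) with (h ^ 4) by ring; lra).
  assert (hpt : forall th, 0 <= th <= PI ->
    let u := 1 + th / h ^ 3 in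
    let w := exp (logW (h ^ 2) p th) in
    let B := residual (h ^ 2) p z th in
    1 <= u /\ h ^ 3 * (u - 1) = th /\ w * u ^ 10 <= K0 /\ gauss h th * u ^ 10 <= K0 /\
    Rabs (w - gauss h th) * u ^ 6 <= K1 * h ^ 2 /\ Rabs B <= K2 * h * u ^ 3).
  { intros th hth u w B.
    set (t := th / h ^ 3).
    assert (ht : 0 <= t) by (apply Rdiv_le_0_compat; lra).
    assert (eth : th = h ^ 3 * t) by (unfold t; field; lra).
    assert (eu : u = 1 + t) by reflexivity.
    assert (hu10 : 0 < u ^ 10) by (apply pow_lt; lra).
    assert (hwk : w * u ^ 10 <= KW) by (apply hW; auto).
    assert (hgk : gauss h th * u ^ 10 <= KG).
    { unfold gauss; rewrite eu.
      replace (PI ^ 2 / 6 / h ^ 6 * th ^ 2) with (PI ^ 2 / 6 * t ^ 2) by (rewrite eth; field; lra).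
      apply hG; auto. }
    split; [lra |]; split; [rewrite eu, eth; ring |].
    split; [unfold K0; lra |]; split; [unfold K0; lra |]; split.
    - generalize (logW_approx (h ^ 2) th p ha hp' (proj1 hth)); intros hl.
      replace (8192 * th ^ 4 / (h ^ 2) ^ 5 + 9 * th ^ 2 / (h ^ 2) ^ 2)
        with (h ^ 2 * (8192 * t ^ 4 + 9 * t ^ 2)) in hl by (rewrite eth; field; lra).
      assert (hu4 : 8192 * t ^ 4 + 9 * t ^ 2 <= 8201 * u ^ 4).
      { assert (t ^ 4 <= u ^ 4) by (apply pow_incr; lra).
        assert (t ^ 2 <= u ^ 4).
        { apply Rle_trans with (u ^ 2); [apply pow_incr; lra | apply Rle_pow; [lra | lia]]. }
        lra. }
      (* Multiplying by [u^4], the degree of the error in [logW], makes the full weight [u^10]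
         available for [w] and the Gaussian. *)
      apply Rmult_le_reg_r with (u ^ 4); [apply pow_lt; lra |].
      rewrite Rmult_assoc; replace (u ^ 6 * u ^ 4) with (u ^ 10) by ring.
      generalize (Rabs_exp_sub_le (logW (h ^ 2) p th) (- (PI ^ 2 / 6 / h ^ 6 * th ^ 2))).
      fold w; fold (gauss h th).
      replace (logW (h ^ 2) p th - - (PI ^ 2 / 6 / h ^ 6 * th ^ 2))
        with (logW (h ^ 2) p th + PI ^ 2 / 6 / (h ^ 2) ^ 3 * th ^ 2) by (field; lra).
      set (A := Rabs (_ + _)) in *; intros hexp.
      apply Rle_trans with (A * ((w + gauss h th) * u ^ 10)).
      + rewrite <- Rmult_assoc; apply Rmult_le_compat_r; lra.
      + apply Rle_trans with ((h ^ 2 * (8201 * u ^ 4)) * (2 * K0)).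
        * apply Rmult_le_compat.
          -- apply Rabs_pos.
          -- apply Rmult_le_pos; [| lra].
             generalize (exp_pos (logW (h ^ 2) p th)) (exp_pos (- (PI ^ 2 / 6 / h ^ 6 * th ^ 2))).
             fold w; fold (gauss h th); lra.
          -- eapply Rle_trans; [apply hl |]; apply Rmult_le_compat_l; lra.
          -- unfold K0; lra.
        * right; unfold K1; ring.
    - generalize (Phi_approx (h ^ 2) th p ha hp' (proj1 hth)); intros hl.
      replace (8192 * th ^ 3 / (h ^ 2) ^ 4 + 5 * th / h ^ 2)
        with (h * (8192 * t ^ 3 + 5 * t)) in hl by (rewrite eth; field; lra).
      assert (hzt : Rabs ((PI ^ 2 / 6 / h ^ 4 - z) * th) <= h * (K * t)).
      { rewrite Rabs_mult, (Rabs_pos_eq th), Rabs_minus_sym by lra.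
        replace (h * (K * t)) with (K / h ^ 2 * th) by (rewrite eth; field; lra).
        apply Rmult_le_compat_r; lra. }
      unfold B, residual.
      replace (Phi (h ^ 2) p th - z * th) with
        ((Phi (h ^ 2) p th - PI ^ 2 / 6 / (h ^ 2) ^ 2 * th) + (PI ^ 2 / 6 / h ^ 4 - z) * th)
        by (field; lra).
      eapply Rle_trans; [apply Rabs_triang |].
      assert (hu3 : 8192 * t ^ 3 + 5 * t + K * t <= K2 * u ^ 3).
      { assert (e1 : t ^ 3 <= u ^ 3) by (apply pow_incr; lra).
        assert (e2 : t <= u ^ 3).
        { apply Rle_trans with (u ^ 1); [lra | apply Rle_pow; [lra | lia]]. }
        generalize (Rmult_le_compat_l K _ _ (Rlt_le _ _ hK) e2); unfold K2; lra. }
      apply (Rmult_le_compat_l h) in hu3; lra. }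
  assert (hw0 : forall th, 0 <= exp (logW (h ^ 2) p th)) by (intros; left; apply exp_pos).
  assert (hg0 : forall th, 0 <= gauss h th) by (intros; left; apply exp_pos).
  assert (hexf : ex_RInt (fourier (h ^ 2) p z) 0 PI) by now apply fourier_ex_RInt.
  assert (hexg : ex_RInt (gauss h) 0 PI) by (apply gauss_ex_RInt; lra).
  assert (hexg2 : ex_RInt (fun th => gauss h th * (th ^ 2 / 2)) 0 PI) by (apply gauss2_ex_RInt; lra).
  generalize (even_part_ex (h ^ 2) p z ha) (odd_part_ex (h ^ 2) p z ha); intros hexe hexo.
  split; [| split].
  - unfold fcoef; rewrite RInt_sub by auto.
    replace (C * h ^ 5) with (C * h ^ 2 * h ^ 3) by ring.
    apply Rabs_RInt_tail_le; auto.
    + eexists; apply is_RInt_lin; apply (RInt_correct (V := R_CompleteNormedModule)); auto.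
    + intros th hth; destruct (hpt th hth) as [q1 [q2 [q3 [q4 [q5 q6]]]]].
      set (u := 1 + th / h ^ 3) in *.
      replace (1 * fourier (h ^ 2) p z th + -1 * gauss h th)
        with (exp (logW (h ^ 2) p th) * cos (residual (h ^ 2) p z th) - gauss h th)
        by (unfold fourier, residual; ring).
      generalize (pw_main K0 K1 K2 h u _ _ _ q1 (hw0 th) q3 q5 q6).
      set (X := Rabs _); intros hx.
      apply Rle_trans with (X * u ^ 4).
      * apply Rmult_le_compat_l; [apply Rabs_pos | apply Rle_pow; [lra | lia]].
      * eapply Rle_trans; [apply hx |]; apply Rmult_le_compat_r; unfold C; lra.
  - apply Rle_trans with (Rabs (even_part (h ^ 2) p z - RInt (fun th => gauss h th * (th ^ 2 / 2)) 0 PI)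
       + 3 / (2 * PI ^ 2) * h ^ 6 * (PI * gauss h PI)).
    + rewrite gauss_parts by lra; set (M := RInt (gauss h) 0 PI).
      assert (h0 : 0 <= 3 / (2 * PI ^ 2) * h ^ 6 * (PI * gauss h PI)).
      { apply Rmult_le_pos; [apply Rmult_le_pos | apply Rmult_le_pos; [lra | auto]].
        - apply Rdiv_le_0_compat; nra.
        - apply pow_le; lra. }
      set (c := 3 / (2 * PI ^ 2)) in *.
      replace (even_part (h ^ 2) p z - c * h ^ 6 * M) with
        ((even_part (h ^ 2) p z - c * h ^ 6 * (M - PI * gauss h PI))
         + - (c * h ^ 6 * (PI * gauss h PI))) by ring.
      eapply Rle_trans; [apply Rabs_triang |]; rewrite Rabs_Ropp, (Rabs_pos_eq _ h0); lra.
    (* The boundary term is exponentially small, but the weighted bound suffices: at [th = PI] one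
       has [u >= 1 / h^3], so two powers of [u] give [h^6]. *)
    + assert (hr : 3 / (2 * PI ^ 2) * h ^ 6 * (PI * gauss h PI) <= K0 * h ^ 11).
      { destruct (hpt PI ltac:(lra)) as [q1 [q2 [_ [q4 _]]]].
        set (u := 1 + PI / h ^ 3) in *.
        assert (hu : 1 / h ^ 3 <= u).
        { unfold u; apply Rle_trans with (PI / h ^ 3); [| lra].
          apply Rmult_le_compat_r; [left; now apply Rinv_0_lt_compat | lra]. }
        assert (hg : gauss h PI <= K0 * h ^ 6).
        { apply Rle_trans with (gauss h PI * u ^ 2 * h ^ 6).
          - assert (hi : 0 <= 1 / h ^ 3) by (apply Rdiv_le_0_compat; lra).
            assert (hu2 : (1 / h ^ 3) ^ 2 <= u ^ 2) by (apply pow_incr; lra).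
            apply Rle_trans with (gauss h PI * (1 / h ^ 3) ^ 2 * h ^ 6); [right; field; lra |].
            apply Rmult_le_compat_r; [apply pow_le; lra |]. apply Rmult_le_compat_l; auto.
          - apply Rmult_le_compat_r; [apply pow_le; lra |].
            eapply Rle_trans; [| apply q4]; apply Rmult_le_compat_l; auto.
            apply Rle_pow; [lra | lia]. }
        assert (h66 : h ^ 6 * h ^ 6 <= h ^ 11).
        { replace (h ^ 6 * h ^ 6) with (h * h ^ 11) by ring.
          assert (0 <= h ^ 11) by (apply pow_le; lra). nra. }
        replace (3 / (2 * PI ^ 2) * h ^ 6 * (PI * gauss h PI))
          with (3 / (2 * PI) * (h ^ 6 * gauss h PI)) by (field; lra).
        apply Rle_trans with (1 * (h ^ 6 * (K0 * h ^ 6))).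
        - apply Rmult_le_compat.
          + apply Rdiv_le_0_compat; lra.
          + apply Rmult_le_pos; [apply pow_le; lra | auto].
          + apply Rle_div_l; lra.
          + apply Rmult_le_compat_l; [apply pow_le; lra | auto].
        - apply (Rmult_le_compat_l K0) in h66; lra. }
      enough (Rabs (even_part (h ^ 2) p z - RInt (fun th => gauss h th * (th ^ 2 / 2)) 0 PI)
        <= (K1 + K0 * K2 ^ 2 + K0) * h ^ 8 * h ^ 3).
      { assert (0 <= h ^ 11) by (apply pow_le; lra).
        replace ((K1 + K0 * K2 ^ 2 + K0) * h ^ 8 * h ^ 3) with ((K1 + K0 * K2 ^ 2 + K0) * h ^ 11) in H by ring.
        assert (0 <= K0 * K2 * h ^ 11) by (apply Rmult_le_pos; lra).
        unfold C; lra. }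
      unfold even_part; rewrite RInt_sub by auto.
      apply Rabs_RInt_tail_le; auto.
      * eexists; apply is_RInt_lin; apply (RInt_correct (V := R_CompleteNormedModule)); auto.
      * intros th hth; destruct (hpt th hth) as [q1 [q2 [q3 [q4 [q5 q6]]]]].
        set (u := 1 + th / h ^ 3) in *.
        generalize (pw_second K0 K1 K2 h u _ _ _ h1 q1 (hw0 th) (hg0 th) q3 q4 q5 q6).
        rewrite q2; intros hx; eapply Rle_trans; [| apply hx].
        right; do 2 f_equal; ring.
  - apply Rle_trans with (K0 * K2 * h ^ 4 * h ^ 3).
    + apply Rabs_RInt_tail_le; auto.
      intros th hth; destruct (hpt th hth) as [q1 [q2 [q3 [q4 [q5 q6]]]]].
      set (u := 1 + th / h ^ 3) in *.
      generalize (pw_odd K0 K2 h u _ _ h1 q1 (hw0 th) q3 q6).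
      rewrite q2; auto.
    + replace (K0 * K2 * h ^ 4 * h ^ 3) with (K0 * K2 * h ^ 7) by ring.
      apply Rmult_le_compat_r; [apply pow_le; lra | unfold C; lra].
Qed.

(** Relative to [I0] one has [D / I0 = k h^6 + O(h^8)] and [S / I0 = O(h^4)]. The logarithms
    contribute [2 D / I0] and squares of size [h^8], the terms linear in [S] having cancelled. *)
Lemma second_difference_algebra (C c : R) : 0 < C -> 0 < c -> exists h0 C', 0 < h0 <= 1 / 5 /\ 0 < C' /\
  forall h M I0 D S, 0 < h <= h0 -> c * h ^ 3 <= M ->
  Rabs (I0 - M) <= C * h ^ 5 -> Rabs (D - 3 / (2 * PI ^ 2) * h ^ 6 * M) <= C * h ^ 11 ->
  Rabs S <= C * h ^ 7 ->
  c / 4 * h ^ 3 <= I0 /\ c / 4 * h ^ 3 <= I0 - D + S /\ c / 4 * h ^ 3 <= I0 - D - S /\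
  Rabs (2 * ln I0 - ln (I0 - D + S) - ln (I0 - D - S) - 3 / PI ^ 2 * h ^ 6) <= C' * h ^ 8.
Proof.
  intros hC hc; generalize PI_gt_3; intros hpi.
  set (k := 3 / (2 * PI ^ 2)).
  assert (hk : 0 < k <= 1).
  { unfold k; split; [apply Rdiv_lt_0_compat; nra |]. apply Rle_div_l; nra. }
  set (X := 4 * C / c).
  assert (hX : 0 < X) by (apply Rdiv_lt_0_compat; lra).
  set (Y := 1 + 2 * X).
  (* [2 X] is twice the error of [D / I0], and [4 Y^2] comes from the quadratic remainders of two
     logarithms. The bound on [h] keeps [Y h^4 <= 1/2], within reach of [ln_one_add_approx]. *)
  exists (Rmin (1 / 5) (1 / (2 * Y))), (2 * X + 4 * Y ^ 2).
  assert (hY : 0 < 1 / (2 * Y)) by (apply Rdiv_lt_0_compat; unfold Y; lra).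
  split; [split; [apply Rmin_glb_lt; lra | apply Rmin_l] |].
  split; [generalize (pow2_ge_0 Y); lra |].
  intros h M I0 D S hh hM hI hD hS.
  assert (hh5 : h <= 1 / 5) by (eapply Rle_trans; [apply hh | apply Rmin_l]).
  assert (hhY : h * Y <= 1 / 2).
  { assert (hq : h <= 1 / (2 * Y)) by (eapply Rle_trans; [apply hh | apply Rmin_r]).
    apply (Rmult_le_compat_r Y) in hq; [| unfold Y; lra].
    replace (1 / (2 * Y) * Y) with (1 / 2) in hq by (field; unfold Y; lra). lra. }
  assert (hX4 : h * X <= 1 / 4) by (unfold Y in hhY; nra).
  assert (eC : C = X * c / 4) by (unfold X; field; lra).
  assert (h3 : 0 < h ^ 3) by (apply pow_lt; lra).
  assert (hM0 : 0 < M) by nra.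
  (* Every error is measured relative to [M >= c h^3]. *)
  assert (hrel : forall n, (1 <= n)%nat -> C * h ^ (3 + n) <= X / 4 * h ^ n * M).
  { intros n hn; rewrite eC, pow_add.
    assert (hn0 : 0 <= X / 4 * h ^ n) by (apply Rmult_le_pos; [lra | apply pow_le; lra]).
    apply (Rmult_le_compat_l _ _ _ hn0) in hM; lra. }
  assert (hI' : Rabs (I0 - M) <= X / 4 * h ^ 2 * M) by (eapply Rle_trans; [apply hI | apply (hrel 2%nat); lia]).
  assert (hD' : Rabs (D - k * h ^ 6 * M) <= X / 4 * h ^ 8 * M)
    by (eapply Rle_trans; [apply hD | apply (hrel 8%nat); lia]).
  assert (hS' : Rabs S <= X / 4 * h ^ 4 * M) by (eapply Rle_trans; [apply hS | apply (hrel 4%nat); lia]).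
  assert (hh2 : h ^ 2 <= h) by nra.
  assert (hI0 : M / 2 <= I0).
  { apply Rabs_le_between in hI'.
    assert (X / 4 * h ^ 2 * M <= M / 2).
    { replace (M / 2) with (1 / 2 * M) by field; apply Rmult_le_compat_r; [lra |]. nra. }
    lra. }
  assert (hI0p : 0 < I0) by lra.
  assert (hrelI : forall n x, Rabs x <= X / 4 * h ^ n * M -> Rabs (x / I0) <= X / 2 * h ^ n).
  { intros n x hx; unfold Rdiv at 1; rewrite Rabs_mult, Rabs_inv, (Rabs_pos_eq I0) by lra.
    apply (Rle_div_l (Rabs x) _ I0); [lra |]. eapply Rle_trans; [apply hx |].
    assert (hn0 : 0 <= X / 4 * h ^ n) by (apply Rmult_le_pos; [lra | apply pow_le; lra]).
    apply Rle_trans with (X / 4 * h ^ n * (2 * I0)); [apply Rmult_le_compat_l; lra | right; field]. }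
  set (d := D / I0); set (s := S / I0).
  assert (hs : Rabs s <= X / 2 * h ^ 4) by (apply hrelI; auto).
  assert (h6 : 0 <= h ^ 6) by (apply pow_le; lra).
  assert (h8 : 0 <= h ^ 8) by (apply pow_le; lra).
  assert (hd : Rabs (d - k * h ^ 6) <= X * h ^ 8).
  { replace (d - k * h ^ 6) with ((D - k * h ^ 6 * M) / I0 + - (k * h ^ 6 * ((I0 - M) / I0)))
      by (unfold d; field; lra).
    eapply Rle_trans; [apply Rabs_triang |].
    rewrite Rabs_Ropp, Rabs_mult, (Rabs_pos_eq (k * h ^ 6)) by nra.
    generalize (hrelI _ _ hI') (hrelI _ _ hD'); intros e1 e2.
    assert (k * h ^ 6 * Rabs ((I0 - M) / I0) <= h ^ 6 * (X / 2 * h ^ 2)).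
    { apply Rmult_le_compat; [nra | apply Rabs_pos | nra | auto]. }
    replace (h ^ 6 * (X / 2 * h ^ 2)) with (X / 2 * h ^ 8) in H by ring. lra. }
  assert (h4 : 0 < h ^ 4) by (apply pow_lt; lra).
  assert (h64 : h ^ 6 <= h ^ 4).
  { replace (h ^ 6) with (h ^ 2 * h ^ 4) by ring. nra. }
  assert (h84 : h ^ 8 <= h ^ 4).
  { replace (h ^ 8) with (h ^ 4 * h ^ 4) by ring.
    assert (h ^ 4 <= 1 ^ 4) by (apply pow_incr; lra). nra. }
  assert (hdY : Rabs d + Rabs s <= Y * h ^ 4).
  { assert (Rabs d <= h ^ 4 + X * h ^ 4).
    { replace d with (k * h ^ 6 + (d - k * h ^ 6)) by ring.
      eapply Rle_trans; [apply Rabs_triang |].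
      rewrite (Rabs_pos_eq (k * h ^ 6)) by nra.
      apply Rplus_le_compat; [nra |].
      eapply Rle_trans; [apply hd |]; apply Rmult_le_compat_l; lra. }
    assert (0 < X * h ^ 4) by nra.
    unfold Y; lra. }
  assert (hsmall : Y * h ^ 4 <= 1 / 2).
  { replace (Y * h ^ 4) with (h * Y * h ^ 3) by ring.
    assert (h ^ 3 <= 1 ^ 3) by (apply pow_incr; lra).
    assert (0 < Y) by (unfold Y; lra). nra. }
  assert (hln : forall y, Rabs y <= Y * h ^ 4 ->
      c / 4 * h ^ 3 <= I0 * (1 + y) /\ Rabs (ln (I0 * (1 + y)) - ln I0 - y) <= 2 * Y ^ 2 * h ^ 8).
  { intros y hy; generalize (ln_one_add_approx y); intros hl.
    assert (hy2 : y ^ 2 <= Y ^ 2 * h ^ 8).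
    { rewrite <- pow2_abs; replace (Y ^ 2 * h ^ 8) with ((Y * h ^ 4) ^ 2) by ring.
      apply pow_incr; split; [apply Rabs_pos | auto]. }
    assert (hyb : - (1 / 2) <= y).
    { assert (hy' : Rabs y <= 1 / 2) by lra. apply Rabs_le_between in hy'; lra. }
    split; [nra |].
    rewrite ln_mult by lra.
    replace (ln I0 + ln (1 + y) - ln I0 - y) with (ln (1 + y) - y) by ring.
    specialize (hl hyb); lra. }
  generalize (Rabs_pos d) (Rabs_pos s); intros hd0 hs0.
  destruct (hln (- d + s)) as [e1 e2].
  { eapply Rle_trans; [apply Rabs_triang |]; rewrite Rabs_Ropp; lra. }
  destruct (hln (- d - s)) as [e3 e4].
  { eapply Rle_trans; [apply Rabs_triang |]; rewrite !Rabs_Ropp; lra. }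
  replace (I0 * (1 + (- d + s))) with (I0 - D + S) in * by (unfold d, s; field; lra).
  replace (I0 * (1 + (- d - s))) with (I0 - D - S) in * by (unfold d, s; field; lra).
  split; [nra |]; split; auto; split; auto.
  replace (3 / PI ^ 2 * h ^ 6) with (2 * (k * h ^ 6)) by (unfold k; field; lra).
  apply Rabs_le_between in e2; apply Rabs_le_between in e4; apply Rabs_le_between in hd.
  apply Rabs_le; lra.
Qed.

(** The lower bounds are exported because they turn the absolute error from the later terms of the
    alternating sum into a relative one. *)
Lemma second_difference_core (K : R) : 0 < K -> exists h0 c C, 0 < h0 <= 1 / 5 /\ 0 < c /\ 0 < C /\
  forall (h z : R) (p : nat), 0 < h <= h0 -> 1 <= INR p * h ^ 4 ->
  Rabs (z - PI ^ 2 / 6 / h ^ 4) <= K / h ^ 2 ->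
  c * h ^ 3 <= fcoef (h ^ 2) p z /\ c * h ^ 3 <= fcoef (h ^ 2) p (z + 1) /\
  c * h ^ 3 <= fcoef (h ^ 2) p (z + -1) /\
  Rabs (2 * ln (fcoef (h ^ 2) p z) - ln (fcoef (h ^ 2) p (z + 1)) - ln (fcoef (h ^ 2) p (z + -1))
        - 3 / PI ^ 2 * h ^ 6) <= C * h ^ 8.
Proof.
  intros hK; destruct (integral_estimates K hK) as [C [hC he]].
  destruct (second_difference_algebra C (exp (-2)) hC (exp_pos _)) as [h0 [C' [hh0 [hC' ha]]]].
  exists h0, (exp (-2) / 4), C'; split; auto; split; [generalize (exp_pos (-2)); lra |].
  split; auto; intros h z p hh hp hz.
  destruct (he h z p ltac:(lra) hp hz) as [q1 [q2 q3]].
  destruct (ha h (RInt (gauss h) 0 PI) (fcoef (h ^ 2) p z) (even_part (h ^ 2) p z) (odd_part (h ^ 2) p z))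
    as [r1 [r2 [r3 r4]]]; auto.
  - apply gauss_mass_ge; lra.
  - assert (ha2 : 0 < h ^ 2) by (apply pow_lt; lra).
    rewrite (fcoef_shift _ p z 1), (fcoef_shift _ p z (-1)) by auto.
    rewrite Rmult_1_l; replace (fcoef (h ^ 2) p z - even_part (h ^ 2) p z + -1 * odd_part (h ^ 2) p z)
      with (fcoef (h ^ 2) p z - even_part (h ^ 2) p z - odd_part (h ^ 2) p z) by ring.
    auto.
Qed.

(** * The alternating sum *)

Lemma zsum_app (l l' : list nat) (f : nat -> Z) : zsum (l ++ l') f = (zsum l f + zsum l' f)%Z.
Proof. induction l as [| x l IH]; simpl; [| rewrite IH]; lia. Qed.

Lemma zsum_zero (l : list nat) (f : nat -> Z) : (forall i, In i l -> f i = 0%Z) -> zsum l f = 0%Z.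
Proof.
  induction l as [| x l IH]; intros h; [reflexivity |].
  rewrite zsum_cons, (h x), IH; simpl; auto; intros i hi; apply h; simpl; auto.
Qed.

Lemma zsum_plus (l : list nat) (f g : nat -> Z) :
  zsum l (fun i => (f i + g i)%Z) = (zsum l f + zsum l g)%Z.
Proof. induction l as [| x l IH]; [reflexivity | rewrite !zsum_cons, IH; lia]. Qed.

Lemma zsum_scal (l : list nat) (c : Z) (f : nat -> Z) :
  zsum l (fun i => (c * f i)%Z) = (c * zsum l f)%Z.
Proof. induction l as [| x l IH]; [simpl; lia | rewrite !zsum_cons, IH; lia]. Qed.

Lemma zsum_swap (l l' : list nat) (f : nat -> nat -> Z) :
  zsum l (fun i => zsum l' (f i)) = zsum l' (fun j => zsum l (fun i => f i j)).
Proof.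
  induction l as [| x l IH].
  - symmetry; apply zsum_zero; reflexivity.
  - rewrite zsum_cons, IH, <- zsum_plus; apply zsum_ext; intros j _; reflexivity.
Qed.

Lemma zsum_delta (n e : nat) (f : nat -> Z) :
  zsum (seq 0 (S n)) (fun t => (f t * (if Nat.eqb e t then 1 else 0))%Z)
  = if (e <=? n)%nat then f e else 0%Z.
Proof.
  induction n as [| n IH].
  - simpl; destruct e; simpl; lia.
  - rewrite seq_S, zsum_app, IH; simpl.
    destruct (Nat.eqb_spec e (S n)) as [-> | h].
    + destruct (Nat.leb_spec (S n) n); [lia |]; rewrite Nat.leb_refl; lia.
    + destruct (Nat.leb_spec e n); destruct (Nat.leb_spec e (S n)); lia.
Qed.

(** Parts larger than [n] cannot occur, so one bound on the parts serves all coefficients up to a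
    given degree. *)
Lemma pcoef_eq (j n : nat) : (n <= j)%nat -> pcoef n = pp j n.
Proof.
  intros h; unfold pcoef; induction h as [| j h IH]; auto.
  rewrite IH, pp_succ; destruct (Nat.ltb_spec n (S j)); lia.
Qed.

Lemma zsum_delta_pcoef (n e : nat) :
  zsum (seq 0 (S n)) (fun t => (pcoef (n - t) * (if Nat.eqb e t then 1 else 0))%Z)
  = ppz (S n) (Z.of_nat n - Z.of_nat e).
Proof.
  rewrite zsum_delta; unfold ppz.
  destruct (Nat.leb_spec e n); destruct (Z.ltb_spec (Z.of_nat n - Z.of_nat e) 0); try lia.
  rewrite (pcoef_eq (S n)) by lia; f_equal; lia.
Qed.

Definition sgnj (j : nat) : Z := if Nat.even j then (-1)%Z else 1%Z.

(** Crude in the quadratic term, but linear growth in [j] with slope [|m|] already gives geometric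
    decay of the terms. *)
Lemma expo_ge (k : nat) (m : Z) (j : nat) : (1 <= k)%nat -> (1 <= j)%nat ->
  (Z.of_nat k - 1 + Z.abs m * Z.of_nat j <= Z.of_nat (expo k m j))%Z.
Proof.
  intros hk hj; unfold expo.
  assert (h : (k - 1 <= j * ((2 * k - 1) * j - 1) / 2)%nat).
  { apply Nat.div_le_lower_bound; [lia |].
    assert ((2 * k - 1) * 1 <= (2 * k - 1) * j)%nat by (apply Nat.mul_le_mono_l; lia). nia. }
  nia.
Qed.

Lemma expo_one (k : nat) (m : Z) : (1 <= k)%nat -> Z.of_nat (expo k m 1) = (Z.of_nat k - 1 + Z.abs m)%Z.
Proof.
  intros hk; unfold expo.
  replace (1 * ((2 * k - 1) * 1 - 1))%nat with ((k - 1) * 2)%nat by lia.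
  rewrite Nat.div_mul by lia; lia.
Qed.

(** For [m <> 0] the exponent is at least [j], so extending the inner range from [j <= t] to
    [j <= n] only adds zeros, and the two sums can be exchanged. *)
Lemma Nk_expand (k : nat) (m : Z) (n : nat) : (1 <= k)%nat -> m <> 0%Z ->
  Nk k m n = zsum (seq 1 n) (fun j => sgnj j *
    (ppz (S n) (Z.of_nat n - Z.of_nat (expo k m j))
     - ppz (S n) (Z.of_nat n - Z.of_nat (expo k m j) - Z.of_nat j)))%Z.
Proof.
  intros hk hm; unfold Nk.
  set (phi := fun t j => (sgnj j * ((if Nat.eqb (expo k m j) t then 1 else 0)
      - (if Nat.eqb (expo k m j + j) t then 1 else 0)))%Z).
  transitivity (zsum (seq 0 (S n)) (fun t => zsum (seq 1 n) (fun j => pcoef (n - t) * phi t j)%Z)).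
  - apply zsum_ext; intros t ht; apply in_seq in ht.
    rewrite zsum_scal; f_equal.
    change (acoef k m t) with (zsum (seq 1 t) (phi t)).
    replace n with (t + (n - t))%nat by lia.
    rewrite seq_app, zsum_app, (zsum_zero (seq (1 + t) (n - t))); [lia |].
    intros j hj; apply in_seq in hj; unfold phi.
    generalize (expo_ge k m j hk ltac:(lia)); intros he.
    destruct (Nat.eqb_spec (expo k m j) t); destruct (Nat.eqb_spec (expo k m j + j) t); nia.
  - rewrite zsum_swap; apply zsum_ext; intros j _.
    replace (Z.of_nat n - Z.of_nat (expo k m j) - Z.of_nat j)%Z
      with (Z.of_nat n - Z.of_nat (expo k m j + j))%Z by lia.
    rewrite <- !zsum_delta_pcoef.
    transitivity (zsum (seq 0 (S n)) (fun t => (sgnj j * (pcoef (n - t) * (if Nat.eqb (expo k m j) t then 1 else 0)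
      + -1 * (pcoef (n - t) * (if Nat.eqb (expo k m j + j) t then 1 else 0))))%Z)).
    + apply zsum_ext; intros t _; unfold phi; ring.
    + rewrite zsum_scal, zsum_plus, zsum_scal; ring.
Qed.

(** Rankin's bound, read off from the trivial estimate of the Fourier integral. *)
Lemma qz_bound (a : R) (p : nat) (z : Z) : 0 < a ->
  Rabs (IZR (qz p z)) <= exp (a * IZR z) / qprod a p.
Proof.
  intros ha; generalize (fcoef_bound a p (IZR z) ha) PI_gt_3 (qprod_pos a p ha); intros hb hpi hq.
  rewrite fcoef_eq, exp_Ropp in hb by auto.
  generalize (exp_pos (a * IZR z)); intros he.
  rewrite !Rabs_mult, (Rabs_pos_eq PI), (Rabs_pos_eq (qprod a p)), (Rabs_pos_eq (/ _)) in hb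
    by (lra || (left; now apply Rinv_0_lt_compat)).
  apply (Rle_div_r _ _ _ hq).
  apply (Rmult_le_reg_l (PI * / exp (a * IZR z))).
  - apply Rmult_lt_0_compat; [lra | now apply Rinv_0_lt_compat].
  - replace (PI * / exp (a * IZR z) * exp (a * IZR z)) with PI by (field; lra). lra.
Qed.

(** The difference telescopes into [j] values of [qz], the one at [y] having the largest bound. *)
Lemma ppz_diff_bound (a : R) (p : nat) (y : Z) (j : nat) : 0 < a ->
  Rabs (IZR (ppz (S p) y - ppz (S p) (y - Z.of_nat j)))
  <= INR j * (exp (a * IZR y) / qprod a p).
Proof.
  intros ha; induction j as [| j IH].
  - rewrite Z.sub_0_r, Z.sub_diag, Rabs_R0; simpl; lra.
  - replace (ppz (S p) y - ppz (S p) (y - Z.of_nat (S j)))%Z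
      with ((ppz (S p) y - ppz (S p) (y - Z.of_nat j)) + qz p (y - Z.of_nat j))%Z.
    2: { unfold qz; replace (y - Z.of_nat (S j))%Z with (y - Z.of_nat j - 1)%Z by lia; lia. }
    rewrite plus_IZR, S_INR; eapply Rle_trans; [apply Rabs_triang |].
    rewrite Rmult_plus_distr_r, Rmult_1_l; apply Rplus_le_compat; auto.
    eapply Rle_trans; [now apply (qz_bound a) |].
    apply Rmult_le_compat_r; [left; now apply Rinv_0_lt_compat, qprod_pos |].
    apply exp_le_compat, Rmult_le_compat_l; [lra |]; apply IZR_le; lia.
Qed.

Lemma zsum_geometric_bound (f : nat -> Z) (B : R) (l s : nat) : 0 <= B ->
  (forall j, (s <= j)%nat -> Rabs (IZR (f j)) <= B * (1 / 2) ^ j) ->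
  Rabs (IZR (zsum (seq s l) f)) <= B * (2 * (1 / 2) ^ s).
Proof.
  intros hB; revert s; induction l as [| l IH]; intros s h.
  - simpl; rewrite Rabs_R0; apply Rmult_le_pos; auto.
    generalize (pow_lt (1 / 2) s ltac:(lra)); lra.
  - simpl seq; rewrite zsum_cons, plus_IZR.
    eapply Rle_trans; [apply Rabs_triang |].
    generalize (h s ltac:(lia)) (IH (S s) ltac:(intros; apply h; lia)); simpl pow; lra.
Qed.

Lemma INR_le_pow2 (j : nat) : INR j <= 2 ^ (j - 1).
Proof.
  destruct j as [| j]; [simpl; lra |].
  replace (S j - 1)%nat with j by lia.
  induction j as [| j IH]; [simpl; lra |].
  rewrite S_INR; simpl pow.
  assert (1 <= 2 ^ j) by (apply pow_R1_Rle; lra). lra.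
Qed.

(** The term [j = 1] is [qz n r] exactly. The bound for the term [j] carries the factor
    [j X^(j-1) <= (2 X)^(j-1)], where [X] is the exponential assumed to be at most [1/4], so the
    rest is a geometric series of ratio [1/2]. The error [d] is that rest in the normalisation of
    [fcoef]. *)
Lemma Nk_fcoef (k : nat) (m : Z) (n : nat) (a : R) :
  (1 <= k)%nat -> m <> 0%Z -> (1 <= n)%nat -> 0 < a -> exp (- (a * IZR (Z.abs m))) <= 1 / 4 ->
  let r := (Z.of_nat n - (Z.of_nat k - 1) - Z.abs m)%Z in
  exists d, Rabs d <= 4 * PI * exp (- (a * IZR (Z.abs m))) /\
    IZR (Nk k m n) = exp (a * IZR r) / (PI * qprod a n) * (fcoef a n (IZR r) + d).
Proof.
  intros hk hm hn ha hX r.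
  set (X := exp (- (a * IZR (Z.abs m)))) in *.
  assert (hX0 : 0 < X) by apply exp_pos.
  generalize PI_gt_3 (qprod_pos a n ha) (exp_pos (a * IZR r)); intros hpi hq he.
  set (T := fun j => (sgnj j *
    (ppz (S n) (Z.of_nat n - Z.of_nat (expo k m j))
     - ppz (S n) (Z.of_nat n - Z.of_nat (expo k m j) - Z.of_nat j)))%Z).
  set (E := exp (a * IZR r) / qprod a n).
  assert (hE : 0 < E) by (apply Rdiv_lt_0_compat; auto).
  assert (e1 : Nk k m n = (qz n r + zsum (seq 2 (n - 1)) T)%Z).
  { rewrite Nk_expand by auto; fold T.
    replace n with (S (n - 1)) at 1 by lia.
    rewrite <- cons_seq, zsum_cons; f_equal.
    unfold T; rewrite expo_one by auto; unfold qz, r; simpl sgnj.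
    replace (Z.of_nat n - (Z.of_nat k - 1 + Z.abs m))%Z
      with (Z.of_nat n - (Z.of_nat k - 1) - Z.abs m)%Z by lia.
    change (Z.of_nat 1) with 1%Z; unfold sgnj; simpl Nat.even; cbv iota; lia. }
  assert (hrest : Rabs (IZR (zsum (seq 2 (n - 1)) T)) <= 4 * X * E).
  { replace (4 * X * E) with ((8 * X * E) * (2 * (1 / 2) ^ 2)) by field.
    apply zsum_geometric_bound; [nra |].
    intros j hj; unfold T; rewrite mult_IZR, Rabs_mult.
    assert (hs : Rabs (IZR (sgnj j)) = 1).
    { unfold sgnj; destruct (Nat.even j); [rewrite Rabs_left | rewrite Rabs_pos_eq]; lra. }
    rewrite hs, Rmult_1_l.
    eapply Rle_trans; [now apply (ppz_diff_bound a) |].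
    assert (hexp : exp (a * IZR (Z.of_nat n - Z.of_nat (expo k m j))) <= exp (a * IZR r) * X ^ (j - 1)).
    { unfold X; replace (exp (- (a * IZR (Z.abs m))) ^ (j - 1))
        with (exp (INR (j - 1) * - (a * IZR (Z.abs m))))
        by (rewrite <- Rpower_pow by apply exp_pos; unfold Rpower; rewrite ln_exp; reflexivity).
      rewrite <- exp_plus; apply exp_le_compat.
      replace (a * IZR r + INR (j - 1) * - (a * IZR (Z.abs m)))
        with (a * (IZR r - INR (j - 1) * IZR (Z.abs m))) by ring.
      apply Rmult_le_compat_l; [lra |].
      rewrite INR_IZR_INZ, <- mult_IZR, <- minus_IZR; apply IZR_le.
      generalize (expo_ge k m j hk ltac:(lia)); unfold r; nia. }
    apply Rle_trans with (2 ^ (j - 1) * (exp (a * IZR r) * X ^ (j - 1) / qprod a n)).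
    - apply Rmult_le_compat; [apply pos_INR | | apply INR_le_pow2 |].
      + left; apply Rdiv_lt_0_compat; auto; apply exp_pos.
      + apply Rmult_le_compat_r; auto; left; now apply Rinv_0_lt_compat.
    - destruct j as [| [| j]]; [lia | lia |].
      replace (S (S j) - 1)%nat with (S j) by lia.
      replace (2 ^ S j * (exp (a * IZR r) * X ^ S j / qprod a n)) with (2 * X * E * (2 * X) ^ j)
        by (rewrite Rpow_mult_distr; unfold E; simpl; field; lra).
      replace (8 * X * E * (1 / 2) ^ S (S j)) with (2 * X * E * (1 / 2) ^ j) by (simpl; field).
      apply Rmult_le_compat_l; [nra |]; apply pow_incr; lra. }
  exists (PI / E * IZR (zsum (seq 2 (n - 1)) T)); split.
  - rewrite Rabs_mult, Rabs_pos_eq by (left; apply Rdiv_lt_0_compat; lra).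
    replace (4 * PI * X) with (PI / E * (4 * X * E)) by (field; lra).
    apply Rmult_le_compat_l; auto; left; apply Rdiv_lt_0_compat; lra.
  - rewrite e1, plus_IZR, fcoef_eq, exp_Ropp by auto; unfold E; field; lra.
Qed.

(** * The function [beta] and the final estimate *)

Lemma beta_pos (l : R) : 1 <= l -> 0 < beta l.
Proof.
  intros h; unfold beta; generalize PI_gt_3; intros.
  apply Rdiv_lt_0_compat; [lra | apply sqrt_lt_R0; lra].
Qed.

Lemma beta_sqr (l : R) : 1 <= l -> beta l ^ 2 = PI ^ 2 / (6 * (l - 1 / 24)).
Proof.
  intros h; unfold beta, Rdiv; rewrite Rpow_mult_distr, pow_inv, pow2_sqrt by lra; reflexivity.
Qed.

Lemma beta_decr (l l' : R) : 1 <= l -> l <= l' -> beta l' <= beta l.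
Proof.
  intros h h'; unfold beta; generalize PI_gt_3; intros.
  apply Rmult_le_compat_l; [lra |]; apply Rinv_le_contravar; [apply sqrt_lt_R0; lra |].
  apply sqrt_le_1; lra.
Qed.

Lemma ln_perturb (P f d : R) (e : R) : 0 < P -> 0 < f -> Rabs d <= e * f -> e <= 1 / 2 ->
  Rabs (ln (P * (f + d)) - ln P - ln f) <= 2 * e.
Proof.
  intros hP hf hd he.
  assert (hy : Rabs (d / f) <= e).
  { unfold Rdiv; rewrite Rabs_mult, Rabs_inv, (Rabs_pos_eq f) by lra.
    apply (Rle_div_l (Rabs d) e f hf); auto. }
  set (y := d / f) in *.
  assert (hy' := hy); apply Rabs_le_between in hy'.
  replace (f + d) with (f * (1 + y)) by (unfold y; field; lra).
  rewrite ln_mult, ln_mult by (try apply Rmult_lt_0_compat; lra).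
  replace (ln P + (ln f + ln (1 + y)) - ln P - ln f) with ((ln (1 + y) - y) + y) by ring.
  eapply Rle_trans; [apply Rabs_triang |].
  generalize (ln_one_add_approx y ltac:(lra)); rewrite <- (pow2_abs y); intros hl.
  generalize (Rabs_pos y); nra.
Qed.

Theorem theorem5p3 (k : nat) (hk : (1 <= k)%nat) :
  exists (C : R) (L : Z), 0 < C /\
    forall (m : Z) (n : nat),
      (L <= Z.of_nat n - Z.abs m)%Z ->
      IZR (Z.abs m) * beta (INR n) >= 3 * ln (INR n) ->
      Rabs (- Delta2 (logN k n) m
            - 3 / PI ^ 2 * beta (IZR (Z.of_nat n - Z.abs m)) ^ 3)
        <= C * beta (IZR (Z.of_nat n - Z.abs m)) ^ 4.
Proof.
  generalize PI_gt_3 PI_lt_16_5; intros hpi hpi'.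
  assert (hk0 : 1 <= INR k) by (apply (le_INR 1); auto).
  destruct (second_difference_core (INR k) ltac:(lra)) as [h0 [c [C [hh0 [hc [hC hcore]]]]]].
  (* Relative error from the terms [j >= 2]: at most [4 PI * 3 h^11] against the lower bound
     [c h^3], that is [A h^8]. *)
  set (A := 12 * PI / c).
  assert (hA : 0 < A) by (apply Rdiv_lt_0_compat; lra).
  set (hs := Rmin h0 (1 / (2 * A))).
  assert (hhs : 0 < hs).
  { apply Rmin_glb_lt; [lra | apply Rdiv_lt_0_compat; lra]. }
  (* Each logarithm is known up to [2 A h^8], and the weights 2, 1, 1 add up to 4, whence [8 A]. In
     the threshold, [2 / hs^4] forces [h <= hs] because [PI^2 / 6 < 2], and the summand 3 ensures
     [n >= 3 >= e], so that [ln n >= 1]. *)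
  exists (C + 8 * A), (up (2 / hs ^ 4 + 3)); split; [lra |].
  intros m n hL hmn.
  set (N := (Z.of_nat n - Z.abs m)%Z) in *.
  assert (hN : 2 / hs ^ 4 + 3 <= IZR N).
  { apply IZR_le in hL; destruct (archimed (2 / hs ^ 4 + 3)) as [h1 _]; lra. }
  assert (hs4 : 0 < hs ^ 4) by (apply pow_lt; auto).
  assert (hs4' : 0 < 2 / hs ^ 4) by (apply Rdiv_lt_0_compat; lra).
  assert (hNn : IZR N <= INR n) by (rewrite INR_IZR_INZ; apply IZR_le; unfold N; lia).
  set (a := beta (IZR N)).
  assert (ha : 0 < a) by (apply beta_pos; lra).
  assert (ha2 : a ^ 2 = PI ^ 2 / (6 * (IZR N - 1 / 24))) by (apply beta_sqr; lra).
  set (h := sqrt a).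
  assert (hh : 0 < h) by (apply sqrt_lt_R0; auto).
  assert (eh : h ^ 2 = a) by (apply pow2_sqrt; lra).
  assert (eh4 : h ^ 4 = PI ^ 2 / (6 * (IZR N - 1 / 24))).
  { rewrite <- ha2, <- eh; ring. }
  assert (hhle : h <= hs).
  { destruct (Rle_lt_dec h hs) as [| hlt]; auto; exfalso.
    assert (h41 : hs ^ 4 <= h ^ 4) by (apply pow_incr; lra).
    rewrite eh4 in h41.
    apply (Rle_div_r _ _ (6 * (IZR N - 1 / 24))) in h41; [| lra].
    assert (h42 : hs ^ 4 * (2 / hs ^ 4 + 2 - 1 / 24) <= hs ^ 4 * (IZR N - 1 / 24))
      by (apply Rmult_le_compat_l; lra).
    replace (hs ^ 4 * (2 / hs ^ 4 + 2 - 1 / 24)) with (2 + hs ^ 4 * (2 - 1 / 24)) in h42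
      by (field; lra).
    nra. }
  assert (hh0' : h <= h0) by (eapply Rle_trans; [apply hhle | apply Rmin_l]).
  assert (hhA : A * h <= 1 / 2).
  { assert (hq : h <= 1 / (2 * A)) by (eapply Rle_trans; [apply hhle | apply Rmin_r]).
    apply (Rmult_le_compat_l A) in hq; [| lra].
    replace (A * (1 / (2 * A))) with (1 / 2) in hq by (field; lra). lra. }
  assert (ha1 : a <= 1 / 25) by (rewrite <- eh; nra).
  assert (hNa : 1 / h ^ 4 <= IZR N).
  { apply Rle_div_l; [apply pow_lt; lra |]. rewrite eh4.
    replace (IZR N * (PI ^ 2 / (6 * (IZR N - 1 / 24))))
      with (IZR N * PI ^ 2 / (6 * (IZR N - 1 / 24))) by (field; lra).
    apply (Rle_div_r 1 _ (6 * (IZR N - 1 / 24))); [lra |].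
    assert (h9 : 9 <= PI ^ 2) by nra.
    apply (Rmult_le_compat_l (IZR N)) in h9; lra. }
  assert (hh4 : 0 < h ^ 4) by (apply pow_lt; lra).
  assert (hp : 1 <= INR n * h ^ 4) by (apply (Rle_div_l 1 _ (h ^ 4)); lra).
  assert (hlnn : 1 <= ln (INR n)).
  { rewrite <- (ln_exp 1); apply ln_le; [apply exp_pos | generalize exp_le_3; lra]. }
  assert (hbn : beta (INR n) <= a) by (apply beta_decr; lra).
  assert (hbn0 : 0 < beta (INR n)) by (apply beta_pos; lra).
  (* Since [beta n <= a <= 1/25] and [ln n >= 1], the hypothesis excludes small [|m|]. With
     [|m| >= 2], both neighbours of [m] are nonzero and have the sign of [m]. *)
  assert (hMR : 1 < IZR (Z.abs m)).
  { assert (0 <= IZR (Z.abs m)) by (apply IZR_le; lia). nra. }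
  assert (hM : (2 <= Z.abs m)%Z) by (apply lt_IZR in hMR; lia).
  assert (hn1 : (1 <= n)%nat) by (apply INR_le; simpl; lra).
  (* The hypothesis and [beta n <= a] give [n^{-3}], and [1 / n <= h^4]. *)
  assert (hXM : exp (- (a * IZR (Z.abs m))) <= h ^ 12).
  { apply Rle_trans with (exp (- (3 * ln (INR n)))).
    - apply exp_le_compat; nra.
    - replace (- (3 * ln (INR n))) with (INR 3 * (- ln (INR n))) by (simpl; ring).
      rewrite <- ln_Rinv by lra.
      change (exp (INR 3 * ln (/ INR n))) with (Rpower (/ INR n) (INR 3)).
      rewrite Rpower_pow by (apply Rinv_0_lt_compat; lra).
      replace (h ^ 12) with ((h ^ 4) ^ 3) by ring.
      apply pow_incr; split; [left; apply Rinv_0_lt_compat; lra |].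
      apply (Rmult_le_reg_l (INR n)); [lra |]. rewrite Rinv_r; lra. }
  set (rr := fun m' : Z => (Z.of_nat n - (Z.of_nat k - 1) - Z.abs m')%Z).
  set (P := fun m' : Z => exp (a * IZR (rr m')) / (PI * qprod a n)).
  assert (hP : forall m', 0 < P m').
  { intros m'; apply Rdiv_lt_0_compat; [apply exp_pos |].
    apply Rmult_lt_0_compat; [lra | now apply qprod_pos]. }
  destruct (hcore h (IZR (rr m)) n ltac:(lra) hp) as [f0 [f1 [f2 f3]]].
  (* The saddle point is [N - 1/24], and [r] misses it by at most [k], well within the tolerance
     [k / h^2]. *)
  { replace (PI ^ 2 / 6 / h ^ 4) with (IZR N - 1 / 24) by (rewrite eh4; field; lra).
    assert (e1 : IZR (rr m) = IZR N - (INR k - 1)).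
    { rewrite INR_IZR_INZ, <- !minus_IZR; f_equal; unfold rr, N; lia. }
    rewrite e1.
    apply Rle_trans with (INR k); [apply Rabs_le; lra |].
    apply Rle_div_r; [rewrite eh; lra |]. rewrite eh; nra. }
  rewrite eh in f0, f1, f2, f3.
  assert (h3 : 0 < h ^ 3) by (apply pow_lt; lra).
  assert (hstep : forall m', (Z.abs m - 1 <= Z.abs m')%Z ->
    c * h ^ 3 <= fcoef a n (IZR (rr m')) ->
    Rabs (logN k n m' - ln (P m') - ln (fcoef a n (IZR (rr m')))) <= 2 * (A * h ^ 8)).
  { intros m' hm' hf.
    (* Lowering [|m|] by one costs a factor [e^a <= 3]. *)
    assert (hX : exp (- (a * IZR (Z.abs m'))) <= 3 * h ^ 12).
    { apply Rle_trans with (exp a * exp (- (a * IZR (Z.abs m)))).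
      - rewrite <- exp_plus; apply exp_le_compat.
        apply IZR_le in hm'; rewrite minus_IZR in hm'; nra.
      - apply Rmult_le_compat; auto; try (left; apply exp_pos).
        apply Rle_trans with (exp 1); [apply exp_le_compat; lra | apply exp_le_3]. }
    assert (h12 : h ^ 12 <= h ^ 11 * (1 / 5)).
    { replace (h ^ 12) with (h ^ 11 * h) by ring.
      apply Rmult_le_compat_l; [apply pow_le |]; lra. }
    assert (h11 : 0 <= h ^ 11 <= (1 / 5) ^ 11)
      by (split; [apply pow_le; lra | apply pow_incr; lra]).
    destruct (Nk_fcoef k m' n a hk ltac:(lia) hn1 ha ltac:(lra)) as [d [hd e]].
    unfold logN; rewrite e.
    change (Z.of_nat n - (Z.of_nat k - 1) - Z.abs m')%Z with (rr m').
    change (exp (a * IZR (rr m')) / (PI * qprod a n)) with (P m').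
    assert (hch : 0 < c * h ^ 3) by (apply Rmult_lt_0_compat; lra).
    assert (h8 : 0 <= h ^ 8) by (apply pow_le; lra).
    apply ln_perturb; [auto | lra | |].
    - apply Rle_trans with (12 * PI * h ^ 11).
      + eapply Rle_trans; [apply hd |].
        apply Rle_trans with (4 * PI * (3 * h ^ 11)); [| lra].
        apply Rmult_le_compat_l; lra.
      + replace (12 * PI * h ^ 11) with (A * h ^ 8 * (c * h ^ 3)) by (unfold A; field; lra).
        apply Rmult_le_compat_l; [apply Rmult_le_pos; lra | auto].
    - replace (A * h ^ 8) with (A * h * h ^ 7) by ring.
      assert (h7 : h ^ 7 <= 1 ^ 7) by (apply pow_incr; lra).
      assert (0 <= h ^ 7) by (apply pow_le; lra).
      nra. }
  (* The prefactor has a logarithm affine in [|m'|], so it drops out of the second difference. *)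
  assert (hlnP : forall m', ln (P m') = a * IZR (rr m') - ln (PI * qprod a n)).
  { intros m'; unfold P; rewrite ln_div, ln_exp; auto; [apply exp_pos |].
    apply Rmult_lt_0_compat; [lra | now apply qprod_pos]. }
  assert (hfinal : forall m1 m2, IZR (rr m1) = IZR (rr m) + 1 -> IZR (rr m2) = IZR (rr m) + -1 ->
    (Z.abs m - 1 <= Z.abs m1)%Z -> (Z.abs m - 1 <= Z.abs m2)%Z ->
    Rabs (2 * logN k n m - logN k n m1 - logN k n m2 - 3 / PI ^ 2 * a ^ 3) <= (C + 8 * A) * a ^ 4).
  { intros m1 m2 e1 e2 hm1 hm2.
    generalize (hstep m ltac:(lia) f0) (hstep m1 hm1 ltac:(rewrite e1; auto))
      (hstep m2 hm2 ltac:(rewrite e2; auto)).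
    rewrite !hlnP, e1, e2; intros g0 g1 g2.
    replace (a ^ 3) with (h ^ 6) by (rewrite <- eh; ring).
    replace (a ^ 4) with (h ^ 8) by (rewrite <- eh; ring).
    apply Rabs_le_between in f3; apply Rabs_le_between in g0;
      apply Rabs_le_between in g1; apply Rabs_le_between in g2.
    apply Rabs_le; lra. }
  unfold Delta2.
  (* The neighbour with smaller absolute value has the larger [r]; the sign of [m] decides which of
     [m - 1] and [m + 1] it is. *)
  destruct (Z_lt_ge_dec 0 m) as [hm0 | hm0].
  - replace (- (logN k n (m + 1) - 2 * logN k n m + logN k n (m - 1)))
      with (2 * logN k n m - logN k n (m - 1)%Z - logN k n (m + 1)%Z) by ring.
    apply hfinal; [rewrite <- plus_IZR; f_equal | rewrite <- plus_IZR; f_equal | |]; unfold rr; lia.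
  - replace (- (logN k n (m + 1) - 2 * logN k n m + logN k n (m - 1)))
      with (2 * logN k n m - logN k n (m + 1)%Z - logN k n (m - 1)%Z) by ring.
    apply hfinal; [rewrite <- plus_IZR; f_equal | rewrite <- plus_IZR; f_equal | |]; unfold rr; lia.
Qed.
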